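(* Let $G$ be a connected real Lie group with identity $e$, let $\mathcal{X}_0=\mathcal{X},\mathcal{X}_1,\ldots,\mathcal{X}_m$ be linear vector fields on $G$ with $[\mathcal{X}_i,\mathcal{X}_j]=0$ for all $i,j=0,1,\ldots,m$, and let $Y_0=Y,Y_1,\ldots,Y_m$ be right invariant vector fields on $G$. Let $u=(u_0,u_1,\ldots,u_m)=(1,u_1,\ldots,u_m)\in\mathbb{R}^{m+1}$ be constant, and consider the curve $$\phi_t(e,u)=\lim_{n\to\infty}\prod_{i=0}^{n-1}\rho\left(\frac{it}{n},\frac{iu_1t}{n},\ldots,\frac{iu_mt}{n}\right)\left(\exp\left(\frac{t}{n}\sum_{j=0}^{m}u_jY_j\right)\right).$$ Then $\phi_t(e,u)$ is the solution of $$\frac{dg}{dt}=(\mathcal{X}+Y)(g)+\sum_{j=1}^{m}u_j(\mathcal{X}_j+Y_j)(g)$$ with initial condition $\phi_0(e,u)=e$.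
   Context: A vector field on $G$ is called linear if its flow is a one-parameter group of automorphisms of $G$. For $i=0,\ldots,m$ let $\varphi^i_t$ denote the flow of $\mathcal{X}_i$ (with $\varphi^0_t=\varphi_t$ the flow of $\mathcal{X}_0=\mathcal{X}$). The map $\rho:\mathbb{R}^{m+1}\to \mathrm{Aut}(G)$ is $\rho(t_0,t_1,\ldots,t_m)=\varphi^0_{t_0}\circ\varphi^1_{t_1}\circ\cdots\circ\varphi^m_{t_m}$; it is a group homomorphism because the $\mathcal{X}_i$ commute. Here $\exp$ is the exponential map of $G$ on the Lie algebra $\mathfrak{g}$ of right invariant vector fields, and $\prod_{i=0}^{n-1}a_i$ means the ordered product $a_0a_1\cdots a_{n-1}$ in $G$. *)

(* Defs.v *)
From HB Require Import structures.
From mathcomp Require Import all_boot all_order all_algebra.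
From mathcomp Require Import all_classical all_reals all_analysis.

Set Implicit Arguments.
Unset Strict Implicit.
Unset Printing Implicit Defensive.

Import Order.TTheory GRing.Theory Num.Theory.
Import numFieldNormedType.Exports.

Local Open Scope classical_set_scope.
Local Open Scope ring_scope.

(* C^oo on the open set U: every iterated directional derivative of f is
   Frechet differentiable on U. In finite dimension this says that all partial
   derivatives of all orders exist and are continuous. *)
Definition smooth_on (R : realType) (V W : normedModType R) (U : set V)
    (f : V -> W) : Prop :=
  forall (vs : seq V) (x : V), U x ->
    differentiable (foldr (fun v (g : V -> W) => 'D_v g) f vs) x.

(* A homeomorphism from an open subset of M onto an open subset of R^d; the
   values of cmap outside cdom, and of cinv outside cmap @` cdom, are
   irrelevant. *)
Record chart (R : realType) (d : nat) (M : topologicalType) := Chart {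
  cdom : set M;
  cmap : M -> 'rV[R]_d;
  cinv : 'rV[R]_d -> M;
  cdom_open : open cdom;
  cimg_open : open (cmap @` cdom);
  cmapK : forall p, cdom p -> cinv (cmap p) = p;
  cmap_continuous : forall p, cdom p -> {for p, continuous cmap};
  cinv_continuous : forall x, (cmap @` cdom) x -> {for x, continuous cinv}
}.

HB.mixin Record isSmoothManifold (R : realType) (d : nat) (M : Type)
    of Topological M := {
  atlas : set (chart R d M);
  atlas_cover : forall p : M, exists2 a, atlas a & cdom a p;
  atlas_smooth : forall a b, atlas a -> atlas b ->
    smooth_on (cmap a @` (cdom a `&` cdom b)) (cmap b \o cinv a);
  manifold_hausdorff : hausdorff_space M;
  manifold_second_countable : @second_countable M
}.

#[short(type="manifoldType")]
HB.structure Definition SmoothManifold (R : realType) (d : nat) :=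
  {M of isSmoothManifold R d M & Topological M}.

(* Multiplication is expressed in the product charts of G * G, which take values
   in the normed space 'rV_d * 'rV_d. *)
HB.mixin Record isLieGroup (R : realType) (d : nat) (G : Type)
    of SmoothManifold R d G & Group G := {
  lie_mul_continuous : continuous (fun p : G * G => (p.1 * p.2)%g);
  lie_mul_smooth : forall a b c : chart R d G, atlas a -> atlas b -> atlas c ->
    smooth_on
      [set (cmap a p.1, cmap b p.2) | p in
        [set p : G * G | [/\ cdom a p.1, cdom b p.2 & cdom c (p.1 * p.2)%g]]]
      (fun x : 'rV[R]_d * 'rV[R]_d => cmap c (cinv a x.1 * cinv b x.2)%g);
  lie_inv_continuous : continuous (fun p : G => (p^-1)%g);
  lie_inv_smooth : forall a b : chart R d G, atlas a -> atlas b ->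
    smooth_on (cmap a @` [set p | cdom a p /\ cdom b (p^-1)%g])
      (fun x : 'rV[R]_d => cmap b ((cinv a x)^-1)%g)
}.

#[short(type="lieGroupType")]
HB.structure Definition LieGroup (R : realType) (d : nat) :=
  {G of isLieGroup R d G & SmoothManifold R d G & Group G}.

Section Manifold.
Variables (R : realType) (d : nat) (M : manifoldType R d).

Definition smooth_map (f : M -> M) : Prop :=
  continuous f /\
  forall a b : chart R d M, atlas a -> atlas b ->
    smooth_on (cmap a @` (cdom a `&` f @^-1` cdom b)) (cmap b \o f \o cinv a).

(* The tangent map of f at p, read in the charts a (around p) and b (around
   f p). *)
Definition tangent_map (f : M -> M) (a b : chart R d M) (p : M) :
    'rV[R]_d -> 'rV[R]_d :=
  'd (cmap b \o f \o cinv a) (cmap a p).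

(* X a p is the coordinate vector of X(p) in the chart a; it is meaningful only
   for a in the atlas and p in the domain of a. Linear combinations of fields
   are then pointwise. *)
Definition field_coords := chart R d M -> M -> 'rV[R]_d.

Definition vector_field (X : field_coords) : Prop :=
  (forall a b p, atlas a -> atlas b -> cdom a p -> cdom b p ->
     X b p = tangent_map id a b p (X a p)) /\
  (forall a, atlas a -> smooth_on (cmap a @` cdom a) (X a \o cinv a)).

(* [X, Y]^k = \sum_i (X^i d_i Y^k - Y^i d_i X^k) in the chart a *)
Definition lie_bracket (X Y : field_coords) : field_coords := fun a p =>
  'd (Y a \o cinv a) (cmap a p) (X a p) - 'd (X a \o cinv a) (cmap a p) (Y a p).

Definition fields_commute (X Y : field_coords) : Prop :=
  forall a p, atlas a -> cdom a p -> lie_bracket X Y a p = 0.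

(* The curve c, defined on the whole real line, solves dc/dt = X(c). Continuity
   is required separately since cmap a is arbitrary outside cdom a. *)
Definition integral_curve (X : field_coords) (c : R -> M) : Prop :=
  continuous c /\
  forall (t : R) (a : chart R d M), atlas a -> cdom a (c t) ->
    is_derive t (1 : R) (cmap a \o c) (X a (c t)).

Definition complete_field (X : field_coords) : Prop :=
  forall p, exists2 c, integral_curve X c & c 0 = p.

(* Integral curves with a given initial point are unique, so for a complete
   field this is its flow; p is a default value. *)
Definition flow (X : field_coords) (t : R) (p : M) : M :=
  xget p [set q | exists c, [/\ integral_curve X c, c 0 = p & q = c t]].

End Manifold.

Section LieGroup.
Variables (R : realType) (d : nat) (G : lieGroupType R d).

Definition automorphism (f : G -> G) : Prop :=
  [/\ {morph f : x y / (x * y)%g}, smooth_map f &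
      exists g : G -> G, [/\ cancel f g, cancel g f & smooth_map g]].

Definition automorphism_group (phi : R -> G -> G) : Prop :=
  [/\ forall t, automorphism (phi t),
      phi 0 = id &
      forall s t, phi (s + t) = phi s \o phi t].

Definition linear_field (X : field_coords G) : Prop :=
  [/\ vector_field X, complete_field X & automorphism_group (flow X)].

Definition right_invariant (Y : field_coords G) : Prop :=
  vector_field Y /\
  forall (g h : G) (a b : chart R d G), atlas a -> atlas b ->
    cdom a g -> cdom b (g * h)%g ->
    Y b (g * h)%g = tangent_map (fun x : G => (x * h)%g) a b g (Y a g).

Definition lie_exp (Y : field_coords G) : G := flow Y 1 1%g.

(* flow (X 0) (s 0) \o flow (X 1) (s 1) \o ... \o flow (X m) (s m) *)
Definition rho (m : nat) (X : 'I_m.+1 -> field_coords G) (s : 'I_m.+1 -> R) :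
    G -> G :=
  \big[(fun f g : G -> G => f \o g)/id]_(i < m.+1) flow (X i) (s i).

End LieGroup.

(* Main.v *)
Require Import Defs.
From HB Require Import structures.
From mathcomp Require Import all_boot all_order all_algebra.
From mathcomp Require Import all_classical all_reals all_analysis.
From mathcomp Require Import lra ring.

Set Implicit Arguments.
Unset Strict Implicit.
Unset Printing Implicit Defensive.

Import Order.TTheory GRing.Theory Num.Theory.
Import numFieldNormedType.Exports.

Local Open Scope classical_set_scope.
Local Open Scope ring_scope.


(** Write X_u for the sum of the fields u_j X_j, Y_u for the sum of the u_j Y_j,
    and rho_s for rho evaluated at s u. The system is dg/dt = (X_u + Y_u)(g).

    The maps rho_s form a one-parameter group of automorphisms generated by X_u.
    This rests on the commutation of the flows of the X_j. If Phi is the flow of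
    X and Psi that of Y, with [X, Y] = 0, then in a chart
    Phi_t(x + eps Y(x)) = Phi_t(x) + eps Y(Phi_t(x)) + O(eps^2), because both
    sides follow X up to such an error, and Gronwall's inequality applies
    (commuting_flow_estimate). So s |-> Phi_t(Psi_s x) is an integral curve of Y
    and coincides with s |-> Psi_s(Phi_t x). This is done near the identity, for
    short times; as the flows consist of automorphisms of a connected group,
    commutation there implies commutation everywhere
    (commuting_automorphism_flows).

    The system has a local solution phi from the identity, by Picard's theorem.
    If phi solves the system and g solves dg/dt = X_u(g), then phi g solves the
    system, as Y_u is right invariant and the rho_s are automorphisms
    (velocity_mul_orbit). By uniqueness this gives the cocycle identity
    phi(s + t) = phi(s) rho_s(phi(t)), which says that (phi(t), t) is a local
    one-parameter group of a semidirect product, and therefore extends to all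
    times (affine_solution). With X_u replaced by 0 the same argument yields the
    one-parameter group eta of exp(t Y_u).

    With h = t / n, the cocycle identity expresses phi(t) as the product of the
    rho_{ih}(phi(h)) for i < n, whereas the product of the theorem is that of
    the rho_{ih}(eta(h)). Since X_u vanishes at the identity, phi and eta have
    the same velocity at 0, and the defect eta(h) phi(h)^-1 is o(h)
    (defect_small). The second product is that of the psi_{ih}(defect h) times
    phi(t), where psi_s is rho_s conjugated by phi(s) (approximation_product).
    These psi_s form again a one-parameter group of automorphisms, so they are
    equi-Lipschitz at the identity for bounded s (twisted_flow_dist1), and the
    correction is a product of n elements of size o(1 / n), which tends to the
    identity (approximation_cvg). *)

(** * Curves in finite dimension *)

Section Calculus.
Variable R : realType.

Lemma is_derive_nearP (V : normedModType R) (y : R -> V) (t : R) (v : V) :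
  is_derive t (1 : R) y v <->
  forall e, 0 < e ->
    \forall h \near (0 : R), `|y (t + h) - y t - h *: v| <= e * `|h|.
Proof.
have quot h : h != 0 -> `|v - h^-1 *: (y (h *: 1 + t) - y t)| * `|h| =
    `|y (t + h) - y t - h *: v|.
  move=> h0; rewrite mulrC -normrZ scalerBr scalerA divff// scale1r distrC.
  by rewrite [h *: 1]mulr1 [h + t]addrC.
split.
- move=> [dy Dy] e e0.
  have : h^-1 *: (y (h *: 1 + t) - y t) @[h --> 0^'] --> v by rewrite -Dy; exact: dy.
  move/cvgrPdist_le => /(_ e e0).
  rewrite /dnbhs /within /=; near_simpl => H.
  near=> h.
  have [->|h0] := eqVneq h 0.
    by rewrite addr0 scale0r subr0 subrr !normr0 mulr0.
  by rewrite -quot// ler_pM2r ?normr_gt0//; move: h0; near: h.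
- move=> H.
  have cv : h^-1 *: (y (h *: 1 + t) - y t) @[h --> 0^'] --> v.
    apply/cvgrPdist_le => e e0.
    near=> h.
    have h0 : h != 0 by near: h; exact: nbhs_dnbhs_neq.
    rewrite -(@ler_pM2r _ `|h|) ?normr_gt0// quot//; near: h.
    by apply: cvg_within; exact: H.
  split; first by apply/cvg_ex; exists v.
  exact/cvg_lim.
Unshelve. all: by end_near. Qed.

Lemma is_derive_continuous (V : normedModType R) (y : R -> V) (t : R) (v : V) :
  is_derive t (1 : R) y v -> {for t, continuous y}.
Proof. by move=> [/derivable1_diffP/differentiable_continuous]. Qed.

Lemma is_derive_unique (V : normedModType R) (y : R -> V) (t : R) (v w : V) :
  is_derive t (1 : R) y v -> is_derive t (1 : R) y w -> v = w.
Proof. by move=> [_ <-] [_ <-]. Qed.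

Lemma is_derive_comp_diff (V W : normedModType R) (f : V -> W) (y : R -> V) (t : R) (v : V) :
  is_derive t (1 : R) y v -> differentiable f (y t) ->
  is_derive t (1 : R) (f \o y) ('d f (y t) v).
Proof.
move=> [/derivable1_diffP dy Dy] df.
have dfy : differentiable (f \o y) t by exact: differentiable_comp.
split; first exact/derivable1_diffP.
by rewrite (deriveE _ dfy) (diff_comp dy df)/= -Dy (deriveE _ dy).
Qed.

Lemma is_derive_pair (V W : normedModType R) (y : R -> V) (z : R -> W) (t : R) (v : V) (w : W) :
  is_derive t (1 : R) y v -> is_derive t (1 : R) z w ->
  is_derive t (1 : R) (fun s => (y s, z s)) (v, w).
Proof.
move=> [/derivable1_diffP dy Dy] [/derivable1_diffP dz Dz].
have dyz : differentiable (fun s => (y s, z s)) t by exact: differentiable_pair.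
split; first exact/derivable1_diffP.
by rewrite (deriveE _ dyz) (diff_pair dy dz)/= -Dy -Dz (deriveE _ dy) (deriveE _ dz).
Qed.

Lemma near_norm_lt (V : normedModType R) (c t : V) (T : R) :
  `|t - c| < T -> \forall s \near t, `|s - c| < T.
Proof.
move=> tT; apply: (@cvgr_norm_lt _ _ _ _ _ (fun s => s - c) (t - c)) => //.
by apply: cvgB; [exact: cvg_id|exact: cvg_cst].
Qed.

Lemma near_abs_lt (t T : R) : `|t| < T -> \forall s \near t, `|s| < T.
Proof.
rewrite -(subr0 t) => /near_norm_lt; rewrite subr0.
by apply: filterS => s; rewrite subr0.
Qed.

Lemma coord_le_norm d (x : 'rV[R]_d) i : `|x 0 i| <= `|x|.
Proof.
by rewrite [leRHS]/Num.Def.normr/= mx_normrE; apply: (le_bigmax _ _ (0, i)).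
Qed.

Lemma norm_le_coord d (x : 'rV[R]_d) M : 0 <= M ->
  (forall i, `|x 0 i| <= M) -> `|x| <= M.
Proof.
move=> M0 H; rewrite [leLHS]/Num.Def.normr/= mx_normrE.
by apply: bigmax_le => // -[i j] _ /=; rewrite (ord1 i).
Qed.

Lemma is_derive_coord d (y : R -> 'rV[R]_d) (t : R) (v : 'rV[R]_d) i :
  is_derive t (1 : R) y v -> is_derive t (1 : R) (fun s => y s 0 i) (v 0 i).
Proof.
move=> [dy Dy]; split; first by have /derivable_mxP := dy; apply.
by rewrite -Dy derive_mx// mxE.
Qed.

Lemma is_derive_of_coord d (y : R -> 'rV[R]_d) (t : R) (v : 'rV[R]_d) :
  (forall i, is_derive t (1 : R) (fun s => y s 0 i) (v 0 i)) ->
  is_derive t (1 : R) y v.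
Proof.
move=> H.
have dy : derivable y t 1.
  by apply/derivable_mxP => i j; rewrite (ord1 i); case: (H j).
split => //; rewrite derive_mx//; apply/rowP => i; rewrite mxE.
by case: (H i).
Qed.

Lemma mean_value_bound d (y dy : R -> 'rV[R]_d) (a b M : R) : a <= b -> 0 <= M ->
  (forall t, a <= t <= b -> is_derive t (1 : R) y (dy t)) ->
  (forall t, a <= t <= b -> `|dy t| <= M) ->
  `|y b - y a| <= M * (b - a).
Proof.
move=> ab M0 Dy yM; apply: norm_le_coord; first by rewrite mulr_ge0// subr_ge0.
move=> i; rewrite !mxE.
have Dyi t : t \in `[a, b] -> is_derive t (1 : R) (fun s => y s 0 i) (dy t 0 i).
  by rewrite in_itv/= => tab; apply: is_derive_coord; exact: Dy.
have Dyo t : t \in `]a, b[ -> is_derive t (1 : R) (fun s => y s 0 i) (dy t 0 i).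
  by move=> tab; apply: Dyi; move: tab; apply: subset_itv; rewrite bnd_simp.
have cy : {within `[a, b], continuous (fun s => y s 0 i)}.
  apply: derivable_within_continuous => t tab.
  by apply: ex_derive; exact: Dyi.
have [c] := MVT_segment ab Dyo cy.
rewrite in_itv/= => cab ->; rewrite normrM [`|b - a|]ger0_norm ?subr_ge0//.
  by rewrite ler_wpM2r ?subr_ge0// (le_trans (coord_le_norm _ _))// yM.
Qed.

Lemma mean_value_bound_sym d (y dy : R -> 'rV[R]_d) (T M : R) : 0 <= M ->
  (forall t, `|t| < T -> is_derive t (1 : R) y (dy t)) ->
  (forall t, `|t| < T -> `|dy t| <= M) ->
  forall s t, `|s| < T -> `|t| < T -> `|y t - y s| <= M * `|t - s|.
Proof.
move=> M0 Dy yM.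
have main s t : s <= t -> `|s| < T -> `|t| < T -> `|y t - y s| <= M * `|t - s|.
  move=> st; rewrite !ltr_norml => /andP[Ts _] /andP[_ tT].
  have inT r : s <= r <= t -> `|r| < T.
    by case/andP=> sr rt; rewrite ltr_norml (lt_le_trans Ts)// (le_lt_trans rt).
  rewrite [`|t - s|]ger0_norm ?subr_ge0//.
  by apply: (mean_value_bound st M0) => r /inT; [exact: Dy|exact: yM].
move=> s t sT tT; have [st|/ltW ts] := leP s t; first exact: main.
by rewrite distrC [`|t - s|]distrC; exact: main.
Qed.

(** The usual estimate by an exponential, on a time so short that the
    exponential may be replaced by 2: the maximum M of |y| satisfies
    M <= |y 0| + T (L M + eta), and T L <= 1/2. *)
Lemma short_gronwall d (y dy : R -> 'rV[R]_d) (T L eta : R) :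
  0 <= L -> 0 <= eta -> L * T <= 2^-1 ->
  (forall t, `|t| < T -> is_derive t (1 : R) y (dy t)) ->
  (forall t, `|t| < T -> `|dy t| <= L * `|y t| + eta) ->
  forall t, `|t| < T -> `|y t| <= 2 * (`|y 0| + T * eta).
Proof.
move=> L0 eta0 LT Dy dyle t tT.
have T0 : 0 < T by apply: le_lt_trans tT.
have tt : - `|t| <= `|t| by rewrite (le_trans _ (normr_ge0 t))// oppr_le0.
have inT s : s \in `[- `|t|, `|t|] -> `|s| < T.
  by rewrite in_itv/= -ler_norml => /le_lt_trans; apply.
have cy : {within `[- `|t|, `|t|], continuous (fun s => `|y s|)}.
  apply: continuous_in_subspaceT => s; rewrite inE => /inT sT.
  have := is_derive_continuous (Dy s sT).
  move=> cs; apply: (@continuous_comp _ _ _ y (fun x => `|x|)) => //.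
  exact: norm_continuous.
have [s sin smax] := EVT_max tt cy.
pose M := `|y s|.
have yM r : `|r| <= `|t| -> `|y r| <= M.
  by rewrite ler_norml => H; apply: smax; rewrite in_itv/=.
have dM r : `|r| <= `|t| -> `|dy r| <= L * M + eta.
  move=> rt; apply: le_trans (dyle r (le_lt_trans rt tT)) _.
  by rewrite lerD2r ler_wpM2l// yM.
have LM0 : 0 <= L * M + eta by rewrite addr_ge0// mulr_ge0// /M normr_ge0.
have st : `|s| <= `|t| by rewrite ler_norml; move: sin; rewrite in_itv/=.
(* By the choice of s, the derivative is bounded by L M + eta between 0 and s. *)
have key : `|y s - y 0| <= (L * M + eta) * `|s|.
  have [s0|s0] := leP 0 s.
    rewrite (ger0_norm s0) -{2}(subr0 s).
    apply: (mean_value_bound s0 LM0) => r /andP[r0 rs].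
      by apply: Dy; rewrite ger0_norm// (le_lt_trans rs)// (le_lt_trans (ler_norm _))// inT.
    by apply: dM; rewrite ger0_norm// (le_trans rs)// (le_trans (ler_norm _)).
  rewrite distrC (ltr0_norm s0) -(sub0r s).
  apply: (mean_value_bound (ltW s0) LM0) => r /andP[rs r0].
    apply: Dy; rewrite ler0_norm// (@le_lt_trans _ _ `|s|) ?inT//.
    by rewrite ltr0_norm// lerN2.
  by apply: dM; rewrite ler0_norm// (@le_trans _ _ `|s|)// ltr0_norm// lerN2.
have Mle : M <= `|y 0| + T * (L * M + eta).
  have : M <= `|y 0| + `|y s - y 0|.
    by rewrite -lerBlDl; exact: lerB_dist.
  move=> /le_trans; apply; rewrite lerD2l (le_trans key)// mulrC ler_wpM2r//.
  by rewrite ltW// (le_lt_trans st).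
apply: (le_trans (yM t (lexx _))).
have M0 : 0 <= M by exact: normr_ge0.
have : L * T * M <= 2^-1 * M by rewrite ler_wpM2r.
move: Mle; rewrite mulrDr mulrA [T * L]mulrC; lra.
Qed.

End Calculus.

(** * Local solutions of Lipschitz equations *)

Section Picard.
Variable R : realType.

Lemma le_of_geometric_slack (a b C : R) :
  (forall n, a <= b + C * 2^-1 ^+ n) -> a <= b.
Proof.
move=> H; apply/ler_addgt0Pr => e e0.
have : C * 2^-1 ^+ n @[n --> \oo] --> C * 0.
  apply: cvgMr; apply: cvg_expr.
  by rewrite ger0_norm ?invr_ge0// invf_lt1// ltr1n.
rewrite mulr0 => /cvgrPdist_lt /(_ e e0) [n _ /(_ n (leqnn n))].
rewrite sub0r normrN => Cn.
by rewrite (le_trans (H n))// lerD2l (le_trans (ler_norm _))// ltW.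
Qed.

Lemma geometric_limit d (u : nat -> 'rV[R]_d) (C : R) :
  (forall n, `|u n.+1 - u n| <= C * 2^-1 ^+ n) ->
  exists l, forall n, `|l - u n| <= 2 * C * 2^-1 ^+ n.
Proof.
move=> uC.
have C0 : 0 <= C by have := uC 0%N; rewrite expr0 mulr1; exact: le_trans.
have step n k : `|u (n + k)%N - u n| <= 2 * C * (2^-1 ^+ n - 2^-1 ^+ (n + k)).
  elim: k => [|k IH]; first by rewrite addn0 !subrr normr0 mulr0.
  rewrite addnS (le_trans (ler_distD (u (n + k)%N) _ _))//.
  rewrite (le_trans (lerD (uC (n + k)%N) IH))// exprS.
  move: (2^-1 ^+ (n + k)) (2^-1 ^+ n) => p q; lra.
have tail n m : (n <= m)%N -> `|u m - u n| <= 2 * C * 2^-1 ^+ n.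
  move=> /subnKC <-; rewrite (le_trans (step _ _))// ler_wpM2l ?mulr_ge0//.
  by rewrite lerBlDr lerDl exprn_ge0// invr_ge0.
have cu : cvg (u @ \oo).
  apply: cauchy_cvg; apply: cauchy_exP => e e0.
  have : C * 2 * 2^-1 ^+ n @[n --> \oo] --> C * 2 * 0.
    apply: cvgMr; apply: cvg_expr.
    by rewrite ger0_norm ?invr_ge0// invf_lt1// ltr1n.
  rewrite mulr0 => /cvgrPdist_lt /(_ e e0) [n _ /(_ n (leqnn n))].
  rewrite sub0r normrN => Cn.
  exists (u n); exists n => // m nm /=.
  rewrite -ball_normE /= distrC (le_lt_trans (tail _ _ nm))//.
  by rewrite (le_lt_trans _ Cn)// [2 * C]mulrC ler_norm.
exists (lim (u @ \oo)) => n; apply/ler_addgt0Pr => e e0.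
have /cvgrPdist_lt /(_ e e0) [m _ Hm] := cu.
have := Hm (maxn m n) (leq_maxl _ _) => /=.
move=> /ltW ue; rewrite (le_trans (ler_distD (u (maxn m n)) _ _))// addrC lerD//.
by rewrite tail// leq_maxr.
Qed.

Lemma lipschitz_map_continuous (V W : normedModType R) (y : V -> W) (M : R) :
  (forall s t, `|y s - y t| <= M * `|s - t|) -> continuous y.
Proof.
move=> yM t; apply/cvgrPdist_le => e e0.
have M0 : 0 < `|M| + 1 by rewrite ltr_wpDl.
near=> s.
rewrite (le_trans (yM _ _))// (@le_trans _ _ ((`|M| + 1) * `|t - s|))//.
  by rewrite ler_wpM2r// (le_trans (ler_norm _))// lerDl.
rewrite mulrC -ler_pdivlMr//; near: s.
by apply: cvgr_dist_le; rewrite ?divr_gt0//; exact: cvg_id.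
Unshelve. all: by end_near. Qed.

(** Integrating from - T, and not from 0, keeps every upper bound of the
    integral to the right of the lower one. *)
Lemma antiderivative d (g : R -> 'rV[R]_d) (x : 'rV[R]_d) (T : R) : 0 < T ->
  continuous g ->
  exists G : R -> 'rV[R]_d, G 0 = x /\
    forall t, `|t| < T -> is_derive t (1 : R) G (g t).
Proof.
move=> T0 cg.
pose F i t := (\int[lebesgue_measure]_(s in [set` `[- T, t]]) (g s 0 i))%R.
have DF i t : `|t| < T -> is_derive t (1 : R) (F i) (g t 0 i).
  rewrite ltr_norml => /andP[Tt tT].
  have cgi : continuous (fun s => g s 0 i).
    move=> s; apply: (@continuous_comp _ _ _ g (fun z : 'rV[R]_d => z 0 i)).
      exact: cg.
    exact: coord_continuous.
  have intg : (@lebesgue_measure R).-integrable [set` `[- T, T]]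
      (EFin \o (fun s => g s 0 i)).
    apply: continuous_compact_integrable; first exact: segment_compact.
    exact: continuous_subspaceT.
  have [dF FE] := @continuous_FTC1_closed R (fun s => g s 0 i) (- T) t T tT intg Tt (cgi t).
  by split; [exact: dF | rewrite -derive1E; exact: FE].
(* Subtracting F i 0 moves the origin of the primitive from - T to 0. *)
exists (fun t => x + \row_i (F i t - F i 0)); split.
  by apply/rowP => i; rewrite !mxE subrr addr0.
move=> t tT; apply: is_derive_of_coord => i.
have -> : (fun s => (x + \row_i (F i s - F i 0)) 0 i) =
    (fun s => (x 0 i - F i 0) + F i s).
  by apply/funext => s; rewrite !mxE addrA addrAC.
have := is_deriveD (is_derive_cst (x 0 i - F i 0) t 1) (DF i t tT).
by rewrite add0r.
Qed.

Definition clamp (r x : R) := Num.max (- r) (Num.min r x).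

Lemma clamp_norm r x : 0 <= r -> `|clamp r x| <= r.
Proof.
by move=> r0; rewrite ler_norml le_max lexx/= ge_max ge_min lexx/= andbT; lra.
Qed.

Lemma clamp_id r x : `|x| <= r -> clamp r x = x.
Proof. by rewrite ler_norml => /andP[? ?]; rewrite /clamp min_r// max_r. Qed.

Lemma clamp_lipschitz r x y : `|clamp r x - clamp r y| <= `|x - y|.
Proof.
have h1 := ler_norm (x - y).
have h2 : y - x <= `|x - y| by rewrite distrC ler_norm.
rewrite /clamp ler_norml !maxEle !minEle.
case: (leP r x) => ?; case: (leP r y) => ?; case: (leP (- r) r) => ?;
  case: (leP (- r) x) => ?; case: (leP (- r) y) => ?; apply/andP; split; lra.
Qed.

(** Picard iteration from x. Time is frozen outside [- T, T], so that the
    iterates are curves on the whole line; as L T <= 1/2, each step halves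
    uniform distances, and the iterates converge geometrically. *)
Lemma picard_bounded d (F : 'rV[R]_d -> 'rV[R]_d) (L M T : R) (x : 'rV[R]_d) :
  0 <= L -> 0 <= M -> 0 < T -> L * T <= 2^-1 ->
  (forall a b, `|F a - F b| <= L * `|a - b|) -> (forall a, `|F a| <= M) ->
  exists y : R -> 'rV[R]_d, [/\ y 0 = x, continuous y,
    forall t, `|y t - x| <= M * T &
    forall t, `|t| < T -> is_derive t (1 : R) y (F (y t))].
Proof.
move=> L0 M0 T0 LT FL FM.
have T2 : 0 < T * 2 by rewrite mulr_gt0.
have inT t : `|clamp T t| < T * 2.
  by rewrite (le_lt_trans (clamp_norm _ (ltW T0)))// ltr_pMr// ltr1n.
have /choice[I HI] : forall g : R -> 'rV[R]_d, exists G : R -> 'rV[R]_d,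
    continuous g -> G 0 = x /\
    forall t, `|t| < T * 2 -> is_derive t (1 : R) G (F (g t)).
  move=> g.
  have [cg|ncg] := pselect (continuous g); last by exists g.
  have cFg : continuous (F \o g).
    move=> t; apply: continuous_comp; first exact: cg.
    exact: lipschitz_map_continuous FL _.
  by have [G] := antiderivative x T2 cFg; exists G.
pose P g t := I g (clamp T t).
have PM g : continuous g -> forall s t, `|P g s - P g t| <= M * `|s - t|.
  move=> cg s t; have [_ DI] := HI g cg.
  have := mean_value_bound_sym M0 DI (fun t _ => FM (g t)) (inT t) (inT s).
  by move=> /le_trans; apply; rewrite ler_wpM2l// clamp_lipschitz.
have Pc g : continuous g -> continuous (P g).
  by move=> cg; exact: lipschitz_map_continuous (PM g cg).
have P0 g : continuous g -> P g 0 = x.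
  by move=> cg; rewrite /P clamp_id ?normr0 ?(ltW T0)//; case: (HI g cg).
have Px g t : continuous g -> `|P g t - x| <= M * T.
  move=> cg; have [I0 DI] := HI g cg.
  rewrite -(P0 g cg) /P [clamp T 0]clamp_id ?normr0 ?(ltW T0)//.
  have := mean_value_bound_sym M0 DI (fun t _ => FM (g t)) _ (inT t).
  move=> /(_ 0); rewrite normr0 subr0 => /(_ T2) /le_trans; apply.
  by rewrite ler_wpM2l// clamp_norm// ltW.
(* P halves uniform distances, because F o g and F o h stay L K apart. *)
have PL g h K t : 0 <= K -> continuous g -> continuous h ->
    (forall s, `|g s - h s| <= K) -> `|P g t - P h t| <= 2^-1 * K.
  move=> K0 cg ch gh; have [I0 DI] := HI g cg; have [J0 DJ] := HI h ch.
  have LK0 : 0 <= L * K by rewrite mulr_ge0.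
  have D s : `|s| < T * 2 ->
      is_derive s (1 : R) (fun s => I g s - I h s) (F (g s) - F (h s)).
    by move=> sT; have := DI s sT; have := DJ s sT => ? ?; exact: is_deriveB.
  have B s : `|s| < T * 2 -> `|F (g s) - F (h s)| <= L * K.
    by move=> _; rewrite (le_trans (FL _ _))// ler_wpM2l.
  have := mean_value_bound_sym LK0 D B _ (inT t).
  move=> /(_ 0); rewrite normr0 I0 J0 subrr !subr0 => /(_ T2) /le_trans; apply.
  rewrite (@le_trans _ _ (L * K * T))// ?ler_wpM2l// ?clamp_norm ?(ltW T0)//.
  by rewrite mulrAC ler_wpM2r.
pose u n := iter n P (cst x).
have uc n : continuous (u n).
  by elim: n => [|n IH]; [exact: cst_continuous|exact: Pc].
have uM n s t : `|u n s - u n t| <= M * `|s - t|.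
  case: n => [|n]; last exact: PM.
  by rewrite /u/= subrr normr0 mulr_ge0.
have MT0 : 0 <= M * T by rewrite mulr_ge0// ltW.
have uS n t : `|u n.+1 t - u n t| <= M * T * 2^-1 ^+ n.
  elim: n t => [|n IH] t; first by rewrite expr0 mulr1 /u/= Px//; exact: cst_continuous.
  rewrite exprS mulrCA; apply: (PL (u n.+1) (u n)) => //.
  by rewrite mulr_ge0// exprn_ge0// invr_ge0.
have /choice[y yu] : forall t, exists l,
    forall n, `|l - u n t| <= 2 * (M * T) * 2^-1 ^+ n.
  move=> t.
  exact: geometric_limit.
have yM s t : `|y s - y t| <= M * `|s - t|.
  apply: (@le_of_geometric_slack _ _ (4 * (M * T))) => n.
  rewrite (le_trans (ler_distD (u n s) _ _))//.
  rewrite (le_trans (lerD (yu s n) (ler_distD (u n t) _ _)))//.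
  rewrite [`|u n t - y t|]distrC.
  rewrite (le_trans (lerD (lexx _) (lerD (uM n s t) (yu t n))))//.
  by rewrite le_eqVlt; apply/orP; left; apply/eqP; ring.
have yc : continuous y by exact: lipschitz_map_continuous yM.
have yP t : y t = P y t.
  apply/eqP; rewrite -subr_eq0 -normr_le0.
  apply: (@le_of_geometric_slack _ _ (2 * (M * T))) => n.
  rewrite add0r (le_trans (ler_distD (u n.+1 t) _ _))//.
  rewrite (le_trans (lerD (yu t n.+1) (lexx _)))//.
  have K0 : 0 <= 2 * (M * T) * 2^-1 ^+ n.
    by apply: mulr_ge0; [exact: mulr_ge0|rewrite exprn_ge0// invr_ge0].
  have uy s : `|u n s - y s| <= 2 * (M * T) * 2^-1 ^+ n by rewrite distrC.
  have := PL (u n) y _ t K0 (uc n) yc uy.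
  rewrite exprS [u n.+1]/(P (u n)); lra.
exists y; split => //.
- by rewrite yP P0.
- by move=> t; rewrite yP Px.
- move=> t tT; have [_ /(_ t)] := HI y yc.
  have tT2 : `|t| < T * 2 by rewrite (lt_trans tT)// ltr_pMr// ltr1n.
  move=> /(_ tT2); apply: near_eq_is_derive.
  near=> s; rewrite yP /P clamp_id//.
  by apply: ltW; near: s; exact: near_abs_lt.
Unshelve. all: by end_near. Qed.

(** The field is frozen outside a cube, which makes it globally Lipschitz and
    bounded; on a short time the solution does not notice. *)
Lemma picard_local d (f : 'rV[R]_d -> 'rV[R]_d) (x0 : 'rV[R]_d) (rho L : R) :
  0 < rho -> 0 <= L ->
  (forall a b, `|a - x0| <= rho -> `|b - x0| <= rho ->
     `|f a - f b| <= L * `|a - b|) ->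
  exists2 T, 0 < T & forall x, `|x - x0| <= rho / 2 ->
    exists y : R -> 'rV[R]_d, [/\ y 0 = x, continuous y,
      forall t, `|y t - x0| < rho &
      forall t, `|t| < T -> is_derive t (1 : R) y (f (y t))].
Proof.
move=> rho0 L0 fL.
pose c z := x0 + \row_i clamp rho ((z - x0) 0 i) : 'rV[R]_d.
have cin z : `|c z - x0| <= rho.
  rewrite /c addrC addKr; apply: norm_le_coord; first exact: ltW.
  by move=> i; rewrite mxE clamp_norm// ltW.
have cL a b : `|c a - c b| <= `|a - b|.
  apply: norm_le_coord => // i; rewrite !mxE.
  rewrite opprD addrACA subrr add0r (le_trans (clamp_lipschitz _ _ _))//.
  rewrite opprB addrA subrK; have := coord_le_norm (a - b) i.
  by rewrite !mxE.
have cid z : `|z - x0| <= rho -> c z = z.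
  move=> zr; apply/rowP => i; rewrite !mxE clamp_id; last first.
    by have := coord_le_norm (z - x0) i; rewrite !mxE => /le_trans; apply.
  by rewrite addrC subrK.
pose M := `|f x0| + L * rho.
have M0 : 0 <= M by rewrite addr_ge0// mulr_ge0// ltW.
have fM z : `|f (c z)| <= M.
  rewrite -(subrK (f x0) (f (c z))) (le_trans (ler_normD _ _))// addrC lerD2l.
  rewrite (le_trans (fL _ _ (cin z) _))// ?subrr ?normr0 ?(ltW rho0)//.
  by rewrite ler_wpM2l.
have flip a b : `|f (c a) - f (c b)| <= L * `|a - b|.
  by rewrite (le_trans (fL _ _ (cin a) (cin b)))// ler_wpM2l.
(* T is chosen for L T <= 1/2 and M T < rho / 2. *)
pose T := (2 * L + 4 * M / rho + 1)^-1.
have den : 0 < 2 * L + 4 * M / rho + 1.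
  by rewrite ltr_wpDl// addr_ge0 ?mulr_ge0// ?invr_ge0 ltW.
have T0 : 0 < T by rewrite invr_gt0.
have MT : M * T < rho / 2.
  rewrite /T ltr_pdivrMr// -subr_gt0.
  have -> : rho / 2 * (2 * L + 4 * M / rho + 1) - M = rho * L + M + rho / 2.
    by field; rewrite gt_eqF.
  by rewrite ltr_wpDl ?divr_gt0// addr_ge0// mulr_ge0// ltW.
have LT : L * T <= 2^-1.
  rewrite /T ler_pdivrMr// mulrDr mulrDr mulrA mulVf ?mul1r ?pnatr_eq0//.
  by rewrite -addrA lerDl addr_ge0// ?mulr_ge0// ?invr_ge0 ltW.
exists T => // x xr.
have [y [y0 yc yx Dy]] := picard_bounded x L0 M0 T0 LT flip fM.
have yr t : `|y t - x0| < rho.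
  rewrite (le_lt_trans (ler_distD x _ _))// (splitr rho).
  by rewrite (le_lt_trans (lerD (yx t) xr))// ltrD2r.
exists y; split => // t tT.
by have := Dy t tT; rewrite cid// ltW.
Qed.

End Picard.

(** * Estimates for smooth maps *)

Section Smooth.
Variable R : realType.

(** A finite family in which every vector has coordinates bounded by its norm.
    Bounds on the derivatives along it are then bounds on the differential;
    both rows and pairs of rows have one. *)
Definition frame (V : normedModType R) (I : finType) (b : I -> V) :=
  forall v, exists2 c : I -> R, v = \sum_i c i *: b i & forall i, `|c i| <= `|v|.

Lemma frame_row d : frame (fun i : 'I_d => delta_mx 0 i : 'rV[R]_d).
Proof.
by move=> v; exists (v 0); [exact: row_sum_delta|exact: coord_le_norm].
Qed.

Lemma frame_pair (V W : normedModType R) (I J : finType) (b : I -> V) (c : J -> W) :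
  frame b -> frame c ->
  frame (fun k : I + J => match k with inl i => (b i, 0) | inr j => (0, c j) end).
Proof.
move=> fb fc [v w]; have [p vp pv] := fb v; have [q wq qw] := fc w.
exists (fun k => match k with inl i => p i | inr j => q j end); last first.
  case=> [i|j]; rewrite prod_normE/= le_max; first by rewrite pv.
  by rewrite qw orbT.
rewrite big_sumType/=; apply/pair_equal_spec; split => /=.
- rewrite !(big_morph fst (fun x y => erefl) erefl)/= [X in _ + X]big1 ?addr0; last first.
    by move=> j _; rewrite scaler0.
  by rewrite {1}vp.
- rewrite !(big_morph snd (fun x y => erefl) erefl)/= [X in X + _]big1 ?add0r; last first.
    by move=> j _; rewrite scaler0.
  by rewrite {1}wq.
Qed.

Lemma smooth_on_derive (V W : normedModType R) (U : set V) (f : V -> W) (v : V) :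
  smooth_on U f -> smooth_on U ('D_v f).
Proof.
by move=> sf vs x Ux; have := sf (rcons vs v) x Ux; rewrite foldr_rcons.
Qed.

Lemma segment_ball (V : normedModType R) (x0 x y : V) (r t : R) :
  `|x - x0| < r -> `|y - x0| < r -> 0 <= t <= 1 ->
  `|(x + t *: (y - x)) - x0| < r.
Proof.
move=> xr yr.
case/andP=> t0 t1.
have -> : x + t *: (y - x) - x0 = (1 - t) *: (x - x0) + t *: (y - x0).
  have -> : y - x = (y - x0) - (x - x0) by rewrite opprB addrA subrK.
  by rewrite addrAC scalerBl scale1r scalerBr addrA addrAC.
have t1' : 0 <= 1 - t by rewrite subr_ge0.
rewrite (le_lt_trans (ler_normD _ _))// !normrZ (ger0_norm t0) (ger0_norm t1').
have [->|tn0] := eqVneq t 0; first by rewrite mul0r addr0 subr0 mul1r.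
have tpos : 0 < t by rewrite lt_neqAle eq_sym tn0.
have : t * `|y - x0| < t * r by rewrite ltr_pM2l.
have : (1 - t) * `|x - x0| <= (1 - t) * r by rewrite ler_wpM2l// ltW.
lra.
Qed.

Lemma is_derive_line (V : normedModType R) (x v : V) (t : R) :
  is_derive t (1 : R) (fun t : R => x + t *: v) v.
Proof.
apply/is_derive_nearP => e e0; near=> h.
by rewrite scalerDl addrA (addrC (x + t *: v)) addrK subrr normr0 mulr_ge0// ltW.
Unshelve. all: by end_near. Qed.

Lemma is_derive_line0 (V : normedModType R) (v : V) (t : R) :
  is_derive t (1 : R) (fun t : R => t *: v) v.
Proof.
have := is_derive_line 0 v t.
by under [X in is_derive _ _ X]funext do rewrite add0r.
Qed.

Section Estimates.
Variables (V : normedModType R) (k : nat) (I : finType) (b : I -> V).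
Hypothesis b_frame : frame b.
Variables (U : set V) (x0 : V).
Hypothesis Ux0 : nbhs x0 U.

(** The derivatives along the frame are continuous, hence bounded near x0, and
    the differential is a combination of them. *)
Lemma smooth_diff_bound (f : V -> 'rV[R]_k) : smooth_on U f ->
  exists2 M, 0 <= M &
    \forall x \near x0, U x /\ forall v, `|'d f x v| <= M * `|v|.
Proof.
move=> sf.
pose M := \sum_i (`|'D_(b i) f x0| + 1).
have M0 : 0 <= M by apply: sumr_ge0 => i _; rewrite addr_ge0.
exists M => //.
have bnd i : \forall x \near x0, `|'D_(b i) f x| <= `|'D_(b i) f x0| + 1.
  have /differentiable_continuous := sf [:: b i] x0 (nbhs_singleton Ux0).
  move=> /= cD; have lt : `|'D_(b i) f x0| < `|'D_(b i) f x0| + 1 by rewrite ltrDl.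
  exact: (@cvgr_norm_le _ _ _ _ _ ('D_(b i) f) ('D_(b i) f x0)).
near=> x.
have Ux : U x by near: x.
have bx i : `|'D_(b i) f x| <= `|'D_(b i) f x0| + 1.
  by move: i; near: x; exact: filter_forall.
split => // v.
have [c vc cv] := b_frame v.
have df := sf [::] x Ux.
rewrite {1}vc linear_sum/= (le_trans (ler_norm_sum _ _ _))//.
rewrite mulr_suml; apply: ler_sum => i _.
rewrite linearZ/= normrZ mulrC -deriveE//; apply: ler_pM => //.
Unshelve. all: by end_near. Qed.

(** The differential is bounded on a ball, which is convex, so the mean value
    bound applies along segments. *)
Lemma smooth_lipschitz (f : V -> 'rV[R]_k) : smooth_on U f ->
  exists M r, [/\ 0 <= M, 0 < r,
    forall x, `|x - x0| < r -> U x &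
    forall x y, `|x - x0| < r -> `|y - x0| < r -> `|f y - f x| <= M * `|y - x|].
Proof.
move=> sf; have [M M0] := smooth_diff_bound sf.
move=> /nbhs_ballP[r /= r0 H].
have {}H x : `|x - x0| < r -> U x /\ forall v, `|'d f x v| <= M * `|v|.
  by move=> xr; apply: H; rewrite -ball_normE/= distrC.
exists M, r; split => //; first by move=> x /H[].
move=> x y xr yr.
have seg := segment_ball xr yr.
pose g t := f (x + t *: (y - x)).
have Dg (t : R) : 0 <= t <= 1 -> is_derive t (1 : R) g ('d f (x + t *: (y - x)) (y - x)).
  move=> t01; have [Uz _] := H _ (seg t t01).
  exact: is_derive_comp_diff (is_derive_line _ _ _) (sf [::] _ Uz).
have := @mean_value_bound R k g _ 0 1 (M * `|y - x|) ler01 _ Dg.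
rewrite /g scale0r addr0 scale1r [x + _]addrC subrK subr0 mulr1.
apply; first by rewrite mulr_ge0.
by move=> t t01; have [_] := H _ (seg t t01); apply.
Qed.

(** The Lipschitz estimate applied to the derivatives along the frame bounds
    the variation of the differential, and the mean value bound is then
    applied to the remainder itself. *)
Lemma smooth_taylor (f : V -> 'rV[R]_k) : smooth_on U f ->
  exists C r, [/\ 0 <= C, 0 < r &
    forall x y, `|x - x0| < r -> `|y - x0| < r ->
      `|f y - f x - 'd f x (y - x)| <= C * `|y - x| ^+ 2].
Proof.
move=> sf.
have /choice[N HN] : forall i, exists N : R * R, [/\ 0 <= N.1, 0 < N.2,
    forall x, `|x - x0| < N.2 -> U x &
    forall x y, `|x - x0| < N.2 -> `|y - x0| < N.2 ->
    `|'D_(b i) f y - 'D_(b i) f x| <= N.1 * `|y - x|].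
  move=> i; have [M [r H]] := smooth_lipschitz (smooth_on_derive (b i) sf).
  by exists (M, r).
have [M0 [r0 [_ r00 Ur0 _]]] := smooth_lipschitz sf.
pose r := \big[Num.min/r0]_i (N i).2.
pose C := \sum_i (N i).1.
have C0 : 0 <= C by apply: sumr_ge0 => i _; case: (HN i).
have rpos : 0 < r.
  by rewrite /r; elim/big_ind: _ => // [p q p0 q0|i _]; [rewrite lt_min p0|case: (HN i)].
have rle0 : r <= r0 by rewrite /r; elim/big_rec: _ => // i z _ zr; rewrite ge_min zr orbT.
have rle i : r <= (N i).2 by rewrite /r (bigD1 i)//= ge_min lexx.
have Ur x : `|x - x0| < r -> U x by move=> xr; apply: Ur0; exact: lt_le_trans rle0.
exists C, r; split => // x y xr yr.
have seg := segment_ball xr yr.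
have dd t v : 0 <= t <= 1 ->
    `|'d f (x + t *: (y - x)) v - 'd f x v| <= C * `|y - x| * `|v|.
  move=> t01; have zr := seg t t01; set z := x + _ in zr *.
  have dz := sf [::] z (Ur z zr); have dx := sf [::] x (Ur x xr).
  have [c vc cv] := b_frame v.
  have dE w : differentiable f w -> 'd f w v = \sum_i c i *: 'D_(b i) f w.
    move=> dw; rewrite [in LHS]vc linear_sum/=.
    by apply: eq_bigr => i _; rewrite linearZ/= deriveE.
  rewrite (dE z dz) (dE x dx) -sumrB (le_trans (ler_norm_sum _ _ _))//.
  rewrite !mulr_suml; apply: ler_sum => i _.
  rewrite -scalerBr normrZ mulrC; apply: ler_pM => //.
  have [N0 _ _ Nl] := HN i.
  rewrite (le_trans (Nl x z _ _)) ?(lt_le_trans xr)// ?(lt_le_trans zr)//.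
  rewrite ler_wpM2l// /z addrC addKr normrZ ler_piMl//.
  by case/andP: t01 => t0 t1; rewrite ger0_norm.
pose g t := f (x + t *: (y - x)) - t *: 'd f x (y - x).
have Dg (t : R) : 0 <= t <= 1 ->
    is_derive t (1 : R) g ('d f (x + t *: (y - x)) (y - x) - 'd f x (y - x)).
  move=> t01; apply: is_deriveB; last exact: is_derive_line0.
  exact: is_derive_comp_diff (is_derive_line _ _ _) (sf [::] _ (Ur _ (seg t t01))).
have := @mean_value_bound R k g _ 0 1 (C * `|y - x| * `|y - x|) ler01 _ Dg.
rewrite /g !scale0r addr0 !scale1r [x + _]addrC !subrK subr0 subr0 mulr1 addrAC.
rewrite -mulrA -expr2; apply; first by rewrite mulr_ge0// exprn_ge0.
by move=> t t01; rewrite expr2 mulrA; exact: dd.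
Qed.

End Estimates.
End Smooth.

(** * Integral curves on manifolds *)

Section ManifoldCurves.
Variables (R : realType) (d : nat) (M : manifoldType R d).
Implicit Types (X Y : field_coords M) (a b : chart R d M) (p q : M) (c : R -> M).

Lemma cinv_image a x : (cmap a @` cdom a) x ->
  cdom a (cinv a x) /\ cmap a (cinv a x) = x.
Proof. by case=> p ap <-; rewrite cmapK. Qed.

Lemma near_cdom a p : cdom a p -> \forall q \near p, cdom a q.
Proof. by move=> ap; apply: open_nbhs_nbhs; split => //; exact: cdom_open. Qed.

Lemma near_cmap a p e : cdom a p -> 0 < e ->
  \forall q \near p, `|cmap a q - cmap a p| < e.
Proof.
move=> ap e0; have /cvgrPdist_lt/(_ e e0) := @cmap_continuous _ _ _ a p ap.
by apply: filterS => q; rewrite distrC.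
Qed.

Lemma nbhs_cimg a p : cdom a p -> nbhs (cmap a p) (cmap a @` cdom a).
Proof.
by move=> ap; apply: open_nbhs_nbhs; split; [exact: cimg_open|exists p].
Qed.

Definition chart_law X := forall a b p, atlas a -> atlas b -> cdom a p -> cdom b p ->
  X b p = tangent_map id a b p (X a p).

(** The regularity that the theorem of Picard needs; unlike smoothness it is
    visibly stable under linear combinations. *)
Definition lipschitz_field X := chart_law X /\
  forall a p, atlas a -> cdom a p -> exists L r, [/\ 0 <= L, 0 < r,
    forall x, `|x - cmap a p| < r -> (cmap a @` cdom a) x &
    forall x y, `|x - cmap a p| < r -> `|y - cmap a p| < r ->
      `|X a (cinv a y) - X a (cinv a x)| <= L * `|y - x|].

Lemma vector_field_lipschitz X : vector_field X -> lipschitz_field X.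
Proof.
move=> [law sm]; split => // a p aa ap.
have [L [r [L0 r0 ir iL]]] :=
  smooth_lipschitz (@frame_row R d) (nbhs_cimg ap) (sm a aa).
by exists L, r; split.
Qed.

Lemma lipschitz_fieldD X Y : lipschitz_field X -> lipschitz_field Y ->
  lipschitz_field (fun a p => X a p + Y a p).
Proof.
move=> [lX iX] [lY iY]; split.
  by move=> a b p aa ab ap bp; rewrite (lX a b p)// (lY a b p)// /tangent_map linearD.
move=> a p aa ap.
have [L [r [L0 r0 ir iL]]] := iX a p aa ap.
have [K [s [K0 s0 _ iK]]] := iY a p aa ap.
exists (L + K), (Num.min r s); split.
- exact: addr_ge0.
- by rewrite lt_min r0.
- by move=> x; rewrite lt_min => /andP[/ir].
- move=> x y; rewrite !lt_min => /andP[xr xs] /andP[yr ys].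
  rewrite opprD addrACA (le_trans (ler_normD _ _))// mulrDl lerD//.
    exact: iL.
  exact: iK.
Qed.

Lemma lipschitz_fieldZ k X : lipschitz_field X -> lipschitz_field (fun a p => k *: X a p).
Proof.
move=> [lX iX]; split.
  by move=> a b p aa ab ap bp; rewrite (lX a b p)// /tangent_map linearZ.
move=> a p aa ap.
have [L [r [L0 r0 ir iL]]] := iX a p aa ap.
exists (`|k| * L), r; split => //; first by rewrite mulr_ge0.
by move=> x y xr yr; rewrite -scalerBr normrZ -mulrA ler_wpM2l// iL.
Qed.

Lemma lipschitz_field0 : lipschitz_field (fun (_ : chart R d M) (_ : M) => 0).
Proof.
split; first by move=> a b p _ _ _ _; rewrite /tangent_map linear0.
move=> a p aa ap; have /nbhs_ballP[r /= r0 H] := nbhs_cimg ap.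
exists 0, r; split => //; first by move=> x xr; apply: H; rewrite -ball_normE/= distrC.
by move=> x y _ _; rewrite subrr normr0 mul0r.
Qed.

Lemma is_derive_translate (V : normedModType R) (f : R -> V) (t s : R) (v : V) :
  is_derive (t + s) (1 : R) f v -> is_derive s (1 : R) (fun r => f (t + r)) v.
Proof.
move=> /is_derive_nearP H; apply/is_derive_nearP => e e0.
by have := H e e0; apply: filterS => h; rewrite addrA.
Qed.

(** A tangent vector is given by its coordinates in the charts around its
    foot point. *)
Definition velocity (v : chart R d M -> 'rV[R]_d) c (t : R) :=
  {for t, continuous c} /\
  forall a, atlas a -> cdom a (c t) -> is_derive t (1 : R) (cmap a \o c) (v a).

Lemma integral_curveE X c :
  integral_curve X c <-> forall t, velocity (X ^~ (c t)) c t.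
Proof.
by split=> [[cc H] t|H]; [split; [exact: cc|exact: H]|split=> t; case: (H t)].
Qed.

(** The transition maps carry the derivative over to the other charts. *)
Lemma velocity_chart (v : chart R d M -> 'rV[R]_d) a c t :
  atlas a -> cdom a (c t) ->
  (forall b, atlas b -> cdom b (c t) -> v b = tangent_map id a b (c t) (v a)) ->
  {for t, continuous c} -> is_derive t (1 : R) (cmap a \o c) (v a) ->
  velocity v c t.
Proof.
move=> aa ac law cc D; split => // b bb bc; rewrite law//.
have sm : differentiable (cmap b \o id \o cinv a) ((cmap a \o c) t).
  by apply: (@atlas_smooth _ _ _ a b aa bb [::]); exists (c t).
have := is_derive_comp_diff D sm; apply: near_eq_is_derive.
near=> s; rewrite /= cmapK//; near: s.
exact: (cc _ (near_cdom ac)).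
Unshelve. all: by end_near. Qed.

Lemma velocity_translate (v : chart R d M -> 'rV[R]_d) c (t s : R) :
  velocity v c (t + s) -> velocity v (fun r => c (t + r)) s.
Proof.
move=> [cc D]; split; last first.
  by move=> a aa ac; exact: (@is_derive_translate _ (cmap a \o c) _ _ _ (D a aa ac)).
apply: (@continuous_comp _ _ _ (fun r => t + r) c) => //.
by apply: cvgD; [exact: cvg_cst|exact: cvg_id].
Qed.

(** Continuity is asked for all times, so that the times at which two such
    curves agree form a closed set. *)
Definition integral_curve_on (T : R) X c := continuous c /\
  forall t, `|t| < T -> velocity (X ^~ (c t)) c t.

Lemma integral_curveW T X c : integral_curve X c -> integral_curve_on T X c.
Proof. by move=> ic; split=> [|t _]; [case: ic|move/integral_curveE : ic]. Qed.

(** In a chart the difference of the two curves satisfies the hypotheses of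
    the short Gronwall estimate with initial value 0. *)
Lemma integral_curves_agree_near X c1 c2 (t : R) : lipschitz_field X -> c1 t = c2 t ->
  (\forall s \near t, velocity (X ^~ (c1 s)) c1 s) ->
  (\forall s \near t, velocity (X ^~ (c2 s)) c2 s) ->
  \forall s \near t, c1 s = c2 s.
Proof.
move=> [_ lX] c12 V1 V2.
have [a aa ac1] := atlas_cover (c1 t).
have ac2 : cdom a (c2 t) by rewrite -c12.
have [L [r [L0 r0 _ iL]]] := lX a _ aa ac1.
have [cc1 _] := nbhs_singleton V1; have [cc2 _] := nbhs_singleton V2.
have : \forall s \near t, [/\ velocity (X ^~ (c1 s)) c1 s, velocity (X ^~ (c2 s)) c2 s,
    cdom a (c1 s) /\ cdom a (c2 s) & `|cmap a (c1 s) - cmap a (c1 t)| < r /\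
    `|cmap a (c2 s) - cmap a (c1 t)| < r].
  near=> s; split; [near: s; exact: V1|near: s; exact: V2|split|split]; near: s.
  - exact: (cc1 _ (near_cdom ac1)).
  - exact: (cc2 _ (near_cdom ac2)).
  - exact: (cc1 _ (near_cmap ac1 r0)).
  - by rewrite c12; exact: (cc2 _ (near_cmap ac2 r0)).
move=> /nbhs_ballP[e /= e0 H].
pose T := Num.min e (2 * L + 1)^-1.
have L1 : 0 < 2 * L + 1 by rewrite ltr_wpDl// mulr_ge0.
have T0 : 0 < T by rewrite lt_min e0 invr_gt0.
have LT : L * T <= 2^-1.
  have T1 : T <= (2 * L + 1)^-1 by rewrite ge_min lexx orbT.
  rewrite (le_trans (ler_wpM2l L0 T1))// ler_pdivrMr//; lra.
have {}H s : `|s| < T -> [/\ velocity (X ^~ (c1 (t + s))) c1 (t + s),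
    velocity (X ^~ (c2 (t + s))) c2 (t + s), cdom a (c1 (t + s)) /\ cdom a (c2 (t + s)) &
    `|cmap a (c1 (t + s)) - cmap a (c1 t)| < r /\
    `|cmap a (c2 (t + s)) - cmap a (c1 t)| < r].
  rewrite lt_min => /andP[se _]; apply: H.
  by rewrite -ball_normE/= opprD addNKr normrN.
pose y s := cmap a (c1 (t + s)) - cmap a (c2 (t + s)).
have Dy s : `|s| < T -> is_derive s (1 : R) y (X a (c1 (t + s)) - X a (c2 (t + s))).
  move=> /H[[_ D1] [_ D2] [a1 a2] _].
  by apply: is_deriveB; [exact: is_derive_translate (D1 a aa a1)|
    exact: is_derive_translate (D2 a aa a2)].
have dyle s : `|s| < T -> `|X a (c1 (t + s)) - X a (c2 (t + s))| <= L * `|y s| + 0.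
  move=> /H[_ _ [a1 a2] [r1 r2]]; rewrite addr0.
  by have := iL _ _ r2 r1; rewrite !cmapK.
have G := short_gronwall L0 (lexx 0) LT Dy dyle.
have y0 : y 0 = 0 by rewrite /y addr0 c12 subrr.
apply/nbhs_ballP; exists T => //= s; rewrite -ball_normE/= distrC => st.
have := G _ st; rewrite y0 normr0 mulr0 addr0 mulr0 normr_le0 subr_eq0 => /eqP.
have [_ _ [a1 a2] _] := H _ st; move: a1 a2; rewrite subrKC => a1 a2 E.
by rewrite -(cmapK a1) -(cmapK a2) E.
Unshelve. all: by end_near. Qed.

Lemma closed_coincidence (S : topologicalType) (f g : S -> M) :
  continuous f -> continuous g -> closed [set s | f s = g s].
Proof.
move=> cf cg s cl /=; apply: (@manifold_hausdorff _ _ M) => A B Af Bg.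
have [z [/= fz [Az Bz]]] := 
  cl _ (@filterI _ (nbhs s) _ (f @^-1` A) (g @^-1` B) (cf s _ Af) (cg s _ Bg)).
by exists (f z); split => //; rewrite fz.
Qed.

(** The times of agreement form an open and closed subset of ]- T, T[, which is
    connected. *)
Lemma integral_curve_on_unique T X c1 c2 : lipschitz_field X ->
  integral_curve_on T X c1 -> integral_curve_on T X c2 -> c1 0 = c2 0 ->
  forall t, `|t| < T -> c1 t = c2 t.
Proof.
move=> lX [cc1 V1] [cc2 V2] c12.
have conn : connected [set t : R | `|t| < T].
  apply/connected_intervalP => s t /=; rewrite !ltr_norml.
  move=> /andP[Ts _] /andP[_ tT] r /andP[sr rt].
  by rewrite ltr_norml (lt_le_trans Ts)// (le_lt_trans rt).
move=> t tT.
have T0 : 0 < T by rewrite (le_lt_trans _ tT).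
suff E : [set s : R | `|s| < T /\ c1 s = c2 s] = [set s : R | `|s| < T].
  by have : [set s : R | `|s| < T] t by []; rewrite -E => -[].
apply: conn.
- by exists 0; rewrite /= normr0.
- exists ([set s : R | c1 s = c2 s]^°); first exact: open_interior.
  rewrite eqEsubset; split=> s /= [sT E]; split => //; last exact: (nbhs_singleton E).
  apply: (integral_curves_agree_near lX E).
    by near=> u; apply: V1; near: u; exact: near_abs_lt.
  by near=> u; apply: V2; near: u; exact: near_abs_lt.
- by exists [set s : R | c1 s = c2 s] => //; exact: closed_coincidence.
Unshelve. all: by end_near. Qed.

Lemma integral_curve_unique X c1 c2 : lipschitz_field X ->
  integral_curve X c1 -> integral_curve X c2 -> c1 0 = c2 0 -> c1 = c2.
Proof.
move=> lX i1 i2 c12; apply/funext => t.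
apply: (@integral_curve_on_unique (`|t| + 1) X) => //; try exact: integral_curveW.
by rewrite ltrDl.
Qed.

Lemma flow_integral_curve X p c : lipschitz_field X ->
  integral_curve X c -> c 0 = p -> flow X ^~ p = c.
Proof.
move=> lX ic c0; apply/funext => t; rewrite /flow.
case: xgetP => [q _ [c' [ic' c'0 ->]]|/(_ (c t))[]]; last by exists c.
by rewrite (integral_curve_unique lX ic' ic)// c'0.
Qed.

Lemma complete_flow X : lipschitz_field X -> complete_field X ->
  forall p, integral_curve X (flow X ^~ p) /\ flow X 0 p = p.
Proof.
move=> lX cX p; have [c ic c0] := cX p.
have E := flow_integral_curve lX ic c0.
by split; [rewrite E|rewrite -[RHS]c0 -E].
Qed.

(** Picard's solutions in the chart a, carried back to M: one duration T serves
    all the starting points near p. *)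
Lemma local_integral_curves X a p (rho : R) : lipschitz_field X -> atlas a -> cdom a p ->
  0 < rho -> exists T r, [/\ 0 < T, 0 < r &
    forall q, cdom a q -> `|cmap a q - cmap a p| < r ->
      exists c, [/\ integral_curve_on T X c, c 0 = q &
        forall t, cdom a (c t) /\ `|cmap a (c t) - cmap a p| < rho]].
Proof.
move=> lX aa ap rho0; have [law iX] := lX.
have [L [r [L0 r0 ir iL]]] := iX a p aa ap.
pose rho' := Num.min rho (r / 2).
have rho'0 : 0 < rho' by rewrite lt_min rho0 divr_gt0.
have rho'r z : z <= rho' -> z < r.
  move=> zr; rewrite (le_lt_trans zr)// (@le_lt_trans _ _ (r / 2))//.
    by rewrite ge_min lexx orbT.
  by rewrite ltr_pdivrMr// ltr_pMr// ltr1n.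
have fL x y : `|x - cmap a p| <= rho' -> `|y - cmap a p| <= rho' ->
    `|X a (cinv a x) - X a (cinv a y)| <= L * `|x - y|.
  by move=> /rho'r xr /rho'r yr; exact: iL.
have [T T0 HT] := picard_local rho'0 L0 fL.
exists T, (rho' / 2); split => //; first by rewrite divr_gt0.
move=> q aq /ltW qr; have [y [y0 yc yr Dy]] := HT _ qr.
have yi t : (cmap a @` cdom a) (y t) by apply: ir; apply: rho'r; rewrite ltW.
have ayt t : cdom a (cinv a (y t)) by case: (cinv_image (yi t)).
have cay t : cmap a (cinv a (y t)) = y t by case: (cinv_image (yi t)).
have cc : continuous (cinv a \o y).
  by move=> t; apply: continuous_comp; [exact: yc|exact: cinv_continuous].
exists (cinv a \o y); split.
- split => // t tT.
  apply: (velocity_chart aa (ayt t)); last 2 first.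
  + exact: cc.
  + have -> : cmap a \o (cinv a \o y) = y by apply/funext => s; exact: cay.
    exact: Dy.
  + by move=> b ab bp; exact: (law a b _ aa ab (ayt t) bp).
- by rewrite /= y0 cmapK.
- by move=> t /=; split => //; rewrite cay (lt_le_trans (yr t))// ge_min lexx.
Qed.

Definition generates (Phi : R -> M -> M) X :=
  forall p, integral_curve X (Phi ^~ p) /\ Phi 0 p = p.

(** By uniqueness the orbits of Phi are, for short times, the local solutions,
    which do not leave the given ball. *)
Lemma flow_stays_near X (Phi : R -> M -> M) a p (rho : R) :
  lipschitz_field X -> generates Phi X ->
  atlas a -> cdom a p -> 0 < rho ->
  exists T r, [/\ 0 < T, 0 < r &
    forall q t, cdom a q -> `|cmap a q - cmap a p| < r -> `|t| < T ->
      cdom a (Phi t q) /\ `|cmap a (Phi t q) - cmap a p| < rho].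
Proof.
move=> lX gX aa ap rho0.
have [T [r [T0 r0 H]]] := local_integral_curves lX aa ap rho0.
exists T, r; split => // q t aq qr tT.
have [c [ic c0 Hc]] := H q aq qr; have [iP P0] := gX q.
have -> : Phi t q = c t; last exact: Hc.
apply: (integral_curve_on_unique lX (integral_curveW T iP) ic) => //.
by rewrite P0 c0.
Qed.

End ManifoldCurves.

(** * Flows of commuting fields *)

Section FlowEstimates.
Variables (R : realType) (d : nat) (M : manifoldType R d).
Implicit Types (X Y : field_coords M) (a b : chart R d M) (p q : M) (c : R -> M).

Lemma chart_ball_nbhs a p (U : set M) : cdom a p -> nbhs p U ->
  exists2 r, 0 < r & forall q, cdom a q -> `|cmap a q - cmap a p| < r -> U q.
Proof.
move=> ap Up.
have ci : {for cmap a p, continuous (cinv a)} by apply: cinv_continuous; exists p.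
have : nbhs (cmap a p) (cinv a @^-1` U) by apply: ci; rewrite cmapK.
move=> /nbhs_ballP[r /= r0 H]; exists r => // q aq qr.
by rewrite -(cmapK aq); apply: H; rewrite -ball_normE/= distrC.
Qed.

Lemma flow_derive X (Phi : R -> M -> M) a q (t : R) : generates Phi X ->
  atlas a -> cdom a (Phi t q) ->
  is_derive t (1 : R) (fun s => cmap a (Phi s q)) (X a (Phi t q)).
Proof. by move=> gX aa aq; have [[_ D] _] := gX q; exact: D. Qed.

(** The mean value bound applied to s |-> Phi s q - s X(p), whose derivative
    X(Phi s q) - X(p) is small near p. *)
Lemma flow_first_order X (Phi : R -> M -> M) a p (e : R) :
  lipschitz_field X -> generates Phi X -> atlas a -> cdom a p -> 0 < e ->
  exists T r, [/\ 0 < T, 0 < r &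
    forall q t, cdom a q -> `|cmap a q - cmap a p| < r -> `|t| < T ->
      cdom a (Phi t q) /\
      `|cmap a (Phi t q) - cmap a q - t *: X a p| <= e * `|t| ].
Proof.
move=> lX gX aa ap e0; have [_ iX] := lX.
have [L [r [L0 r0 _ iL]]] := iX a p aa ap.
have L1 : 0 < L + 1 by rewrite ltr_wpDl.
have rho0 : 0 < Num.min r (e / (L + 1)) by rewrite lt_min r0 divr_gt0.
have [T [s [T0 s0 H]]] := flow_stays_near lX gX aa ap rho0.
exists T, s; split => // q t aq qs tT; have [aP _] := H q t aq qs tT; split => //.
have Dg u : `|u| < T -> is_derive u (1 : R)
    (fun u => cmap a (Phi u q) - u *: X a p) (X a (Phi u q) - X a p).
  move=> uT; have [aPu _] := H q u aq qs uT.
  by apply: is_deriveB; [exact: flow_derive|exact: is_derive_line0].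
have Bg u : `|u| < T -> `|X a (Phi u q) - X a p| <= e.
  move=> uT; have [aPu] := H q u aq qs uT; rewrite lt_min => /andP[ur ue].
  have := iL (cmap a p) (cmap a (Phi u q)); rewrite !cmapK// subrr normr0.
  move=> /(_ r0 ur) /le_trans; apply.
  rewrite (@le_trans _ _ ((L + 1) * `|cmap a (Phi u q) - cmap a p|))//.
    by rewrite ler_wpM2r// lerDl.
  by rewrite mulrC -ler_pdivlMr// ltW.
have := mean_value_bound_sym (ltW e0) Dg Bg _ tT.
move=> /(_ 0); rewrite normr0 => /(_ T0).
have [_ P0] := gX q.
by rewrite P0 scale0r !subr0 addrAC.
Qed.

(** Phi t q = q + t X(c 0) + o(t) uniformly for q near c 0, so that the moving
    point c t may be substituted for q. *)
Lemma velocity_flow_along X (Phi : R -> M -> M) c (w : chart R d M -> 'rV[R]_d) :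
  lipschitz_field X -> generates Phi X -> velocity w c 0 ->
  velocity (fun a => X a (c 0) + w a) (fun t => Phi t (c t)) 0.
Proof.
move=> lX gX [cc Dc].
have P0 : Phi 0 (c 0) = c 0 by case: (gX (c 0)).
have near_c a r : cdom a (c 0) -> 0 < r ->
    \forall t \near (0 : R), cdom a (c t) /\ `|cmap a (c t) - cmap a (c 0)| < r.
  move=> ac r0; near=> t; split; near: t.
    exact: (cc _ (near_cdom ac)).
  exact: (cc _ (near_cmap ac r0)).
split.
- move=> U; rewrite P0 => cU.
  have [a aa ac] := atlas_cover (c 0).
  have [rho rho0 HU] := chart_ball_nbhs ac cU.
  have [T [r [T0 r0 H]]] := flow_stays_near lX gX aa ac rho0.
  change (\forall t \near (0 : R), U (Phi t (c t))); near=> t.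
  have [act actr] : cdom a (c t) /\ `|cmap a (c t) - cmap a (c 0)| < r.
    by near: t; exact: near_c.
  have tT : `|t| < T by near: t; apply: near_abs_lt; rewrite normr0.
  by have [aP] := H _ _ act actr tT; exact: HU.
- move=> a aa; rewrite P0 => ac.
  apply/is_derive_nearP => e e0.
  have e2 : 0 < e / 2 by rewrite divr_gt0.
  have [T [r [T0 r0 H]]] := flow_first_order lX gX aa ac e2.
  have /is_derive_nearP/(_ _ e2) Hc := Dc a aa ac.
  near=> t; rewrite /= add0r P0.
  have [act actr] : cdom a (c t) /\ `|cmap a (c t) - cmap a (c 0)| < r.
    by near: t; exact: near_c.
  have tT : `|t| < T by near: t; apply: near_abs_lt; rewrite normr0.
  have [_ E1] := H _ _ act actr tT.
  have E2 : `|(cmap a \o c) (0 + t) - (cmap a \o c) 0 - t *: w a| <= e / 2 * `|t|.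
    by near: t; exact: Hc.
  move: E2; rewrite /= add0r => E2.
  have -> : cmap a (Phi t (c t)) - cmap a (c 0) - t *: (X a (c 0) + w a) =
      (cmap a (Phi t (c t)) - cmap a (c t) - t *: X a (c 0)) +
      (cmap a (c t) - cmap a (c 0) - t *: w a).
    by rewrite scalerDr opprD [RHS]addrACA subrKA.
  by rewrite (le_trans (ler_normD _ _))// (splitr e) mulrDl lerD.
Unshelve. all: by end_near. Qed.

(** The invariance of g under the flow of f, to second order in eps: both
    w and u + eps g(u) follow f up to an error in eps^2, the latter because
    Dg(f) = Df(g). *)
Lemma commuting_flow_estimate (f g : 'rV[R]_d -> 'rV[R]_d) (x0 : 'rV[R]_d)
    (L C B T rho r eps : R) (u w : R -> 'rV[R]_d) :
  0 <= L -> 0 <= C -> 0 < T -> L * T <= 2^-1 ->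
  (forall x y, `|x - x0| < r -> `|y - x0| < r -> `|f y - f x| <= L * `|y - x|) ->
  (forall x y, `|x - x0| < r -> `|y - x0| < r ->
    `|f y - f x - 'd f x (y - x)| <= C * `|y - x| ^+ 2) ->
  (forall x, `|x - x0| < r -> `|g x| <= B) ->
  (forall x, `|x - x0| < r -> differentiable g x /\ 'd g x (f x) = 'd f x (g x)) ->
  0 <= B -> rho + `|eps| * B <= r ->
  (forall t, `|t| < T -> `|u t - x0| < rho /\ is_derive t (1 : R) u (f (u t))) ->
  (forall t, `|t| < T -> `|w t - x0| < rho /\ is_derive t (1 : R) w (f (w t))) ->
  forall t, `|t| < T -> `|w t - u t - eps *: g (u t)| <=
    2 * (`|w 0 - u 0 - eps *: g (u 0)| + T * (C * (B * `|eps|) ^+ 2)).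
Proof.
move=> L0 C0 T0 LT fL fC gB dg B0 rhoB Hu Hw.
have rho_r : rho <= r by rewrite (le_trans _ rhoB)// lerDl mulr_ge0.
have ur t : `|t| < T -> `|u t - x0| < r.
  by move=> /Hu[ut _]; exact: lt_le_trans ut rho_r.
have wr t : `|t| < T -> `|w t - x0| < r.
  by move=> /Hw[wt _]; exact: lt_le_trans wt rho_r.
have vr t : `|t| < T -> `|u t + eps *: g (u t) - x0| < r.
  move=> tT; rewrite addrAC (le_lt_trans (ler_normD _ _))//.
  rewrite (lt_le_trans _ rhoB)// ltr_leD//; first by case: (Hu t tT).
  by rewrite normrZ ler_wpM2l// gB// ur.
have DF t : `|t| < T -> is_derive t (1 : R) (fun t => w t - u t - eps *: g (u t))
    (f (w t) - f (u t) - eps *: 'd g (u t) (f (u t))).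
  move=> tT; have [_ Du] := Hu t tT; have [_ Dw] := Hw t tT.
  have [dgu _] := dg _ (ur t tT).
  have Dgu := is_derive_comp_diff Du dgu.
  by apply: is_deriveB; exact: is_deriveZ.
have BF t : `|t| < T -> `|f (w t) - f (u t) - eps *: 'd g (u t) (f (u t))| <=
    L * `|w t - u t - eps *: g (u t)| + C * (B * `|eps|) ^+ 2.
  move=> tT; have [_ ->] := dg _ (ur t tT).
  rewrite -linearZ/= -(subrKA (f (u t + eps *: g (u t))) (f (w t))) -addrA.
  rewrite (le_trans (ler_normD _ _))// lerD//.
    have := fL _ _ (vr t tT) (wr t tT).
    by rewrite opprD addrA.
  have := fC _ _ (ur t tT) (vr t tT).
  rewrite [u t + _ - _]addrC addKr => /le_trans; apply.
  rewrite ler_wpM2l// ler_pXn2r ?nnegrE ?mulr_ge0// normrZ mulrC.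
  by rewrite ler_wpM2r// gB// ur.
have eta0 : 0 <= C * (B * `|eps|) ^+ 2 by rewrite mulr_ge0// exprn_ge0// mulr_ge0.
exact: short_gronwall L0 eta0 LT DF BF.
Qed.

(** The curve s |-> Phi t (Psi s q) is shown to be an integral curve of Y, by
    the estimate above; so is s |-> Psi s (Phi t q), with the same origin. *)
Lemma commuting_fields_flows X Y (Phi Psi : R -> M -> M) a p :
  vector_field X -> vector_field Y -> fields_commute X Y ->
  generates Phi X -> generates Psi Y -> (forall t, continuous (Phi t)) ->
  atlas a -> cdom a p ->
  exists T r, [/\ 0 < T, 0 < r &
    forall q s t, cdom a q -> `|cmap a q - cmap a p| < r -> `|s| < T -> `|t| < T ->
      Phi t (Psi s q) = Psi s (Phi t q)].
Proof.
move=> vX vY cXY gX gY cPhi aa ap.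
have lX := vector_field_lipschitz vX; have lY := vector_field_lipschitz vY.
have [_ sX] := vX; have [lawY sY] := vY.
have [L [r1 [L0 r10 _ iL]]] := lX.2 a p aa ap.
have [C [r2 [C0 r20 iC]]] := smooth_taylor (@frame_row R d) (nbhs_cimg ap) (sX a aa).
have [K [r3 [K0 r30 ir iK]]] := lY.2 a p aa ap.
pose r := Num.min r1 (Num.min r2 r3).
have r0 : 0 < r by rewrite !lt_min r10 r20.
have lt_r1 z : z < r -> z < r1 by rewrite !lt_min => /andP[].
have lt_r2 z : z < r -> z < r2 by rewrite !lt_min => /and3P[].
have lt_r3 z : z < r -> z < r3 by rewrite !lt_min => /and3P[].
have rho0 : 0 < r / 2 by rewrite divr_gt0.
have [T1 [r4 [T10 r40 HX]]] := flow_stays_near lX gX aa ap rho0.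
have [T2 [r5 [T20 r50 HY]]] := flow_stays_near lY gY aa ap r40.
have L1 : 0 < 2 * L + 1 by rewrite ltr_wpDl// mulr_ge0.
pose T := Num.min T1 (Num.min T2 (2 * L + 1)^-1).
have T0 : 0 < T by rewrite !lt_min T10 T20 invr_gt0.
have lt_T1 z : z < T -> z < T1 by rewrite !lt_min => /andP[].
have lt_T2 z : z < T -> z < T2 by rewrite !lt_min => /and3P[].
have LT : L * T <= 2^-1.
  have T3 : T <= (2 * L + 1)^-1 by rewrite !ge_min lexx !orbT.
  rewrite (le_trans (ler_wpM2l L0 T3))// ler_pdivrMr//; lra.
pose f := X a \o cinv a; pose g := Y a \o cinv a.
pose B := `|Y a p| + K * r.
have B0 : 0 <= B by rewrite addr_ge0// mulr_ge0// ltW.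
have gB x : `|x - cmap a p| < r -> `|g x| <= B.
  move=> xr; have := iK (cmap a p) x; rewrite subrr normr0 cmapK//.
  move=> /(_ r30 (lt_r3 _ xr)) gx.
  rewrite /B -(subrK (Y a p) (g x)) addrC (le_trans (ler_normD _ _))// lerD2l.
  by rewrite (le_trans gx)// ler_wpM2l// ltW.
have fL x y : `|x - cmap a p| < r -> `|y - cmap a p| < r -> `|f y - f x| <= L * `|y - x|.
  by move=> /lt_r1 xr /lt_r1 yr; exact: iL.
have fC x y : `|x - cmap a p| < r -> `|y - cmap a p| < r ->
    `|f y - f x - 'd f x (y - x)| <= C * `|y - x| ^+ 2.
  by move=> /lt_r2 xr /lt_r2 yr; exact: iC.
have dg x : `|x - cmap a p| < r -> differentiable g x /\ 'd g x (f x) = 'd f x (g x).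
  move=> /lt_r3/ir xi; split; first exact: (sY a aa [::] x xi).
  have [ax axK] := cinv_image xi.
  have := cXY a (cinv a x) aa ax; rewrite /lie_bracket axK => /eqP.
  by rewrite subr_eq0 => /eqP.
exists T, r5; split => // q s0 t0 aq qr sT tT.
(* The orbits of both flows are confined to the ball of radius r / 2, which
   leaves room for the displacement eps g(u). *)
have HP s t : `|s| < T -> `|t| < T -> cdom a (Phi t (Psi s q)) /\
    `|cmap a (Phi t (Psi s q)) - cmap a p| < r / 2.
  move=> /lt_T2 sT2 /lt_T1 tT1; have [aq' qr'] := HY q s aq qr sT2.
  exact: HX.
have HD s t : `|s| < T -> `|t| < T ->
    `|cmap a (Phi t (Psi s q)) - cmap a p| < r / 2 /\
    is_derive t (1 : R) (fun t => cmap a (Phi t (Psi s q))) (f (cmap a (Phi t (Psi s q)))).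
  move=> sT' tT'; have [aP Pr] := HP s t sT' tT'; split => //.
  by rewrite /f /= cmapK//; exact: flow_derive.
have Yc : integral_curve_on T Y (fun s => Phi t0 (Psi s q)).
  have cc : continuous (fun s => Phi t0 (Psi s q)).
    move=> s; apply: (@continuous_comp _ _ _ (Psi ^~ q) (Phi t0)); last exact: cPhi.
    by have [[cPsi _] _] := gY q; exact: cPsi.
  split => // s sT'; have [ac _] := HP s t0 sT' tT.
  apply: (velocity_chart aa ac); [|exact: cc|].
    by move=> b ab bc; exact: (lawY a b _ aa ab ac bc).
  apply/is_derive_nearP => e e0.
  have e4 : 0 < e / 4 by rewrite divr_gt0.
  have [aq' _] := HY q s aq qr (lt_T2 _ sT').
  have /is_derive_nearP/(_ _ e4) HPsi := flow_derive gY aa aq'.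
  pose k := 2 * T * C * B ^+ 2.
  have k0 : 0 <= k by rewrite !mulr_ge0// ?exprn_ge0// ltW.
  near=> h.
  have shT : `|s + h| < T.
    near: h; have : \forall z \near s, `|z| < T by exact: near_abs_lt.
    have -> : s = s + 0 by rewrite addr0.
    have ct : (fun h : R => s + h) @ 0 --> s + 0.
      by apply: cvgD; [exact: cvg_cst|exact: cvg_id].
    by move=> /ct; rewrite addr0.
  have hB : r / 2 + `|h| * B <= r.
    rewrite -lerBrDl [X in X - _]splitr addrK.
    rewrite (@le_trans _ _ (`|h| * (B + 1)))//; first by rewrite ler_wpM2l// lerDl.
    rewrite -ler_pdivlMr ?ltr_wpDl//; apply: ltW; near: h.
    by apply: near_abs_lt; rewrite normr0 divr_gt0// ltr_wpDl.
  have hk : k * `|h| <= e / 2.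
    rewrite (@le_trans _ _ (`|h| * (k + 1)))//; first by rewrite mulrC ler_wpM2l// lerDl.
    rewrite -ler_pdivlMr ?ltr_wpDl//; apply: ltW; near: h.
    by apply: near_abs_lt; rewrite normr0 divr_gt0// ?ltr_wpDl// divr_gt0.
  have E := commuting_flow_estimate L0 C0 T0 LT fL fC gB dg B0 hB
    (fun t => HD s t sT') (fun t => HD (s + h) t shT) tT.
  have [_ P0s] := gX (Psi s q); have [_ P0h] := gX (Psi (s + h) q).
  move: E; rewrite P0s P0h /g /= !cmapK// => E; apply: (le_trans E).
  have : `|cmap a (Psi (s + h) q) - cmap a (Psi s q) - h *: Y a (Psi s q)| <= e / 4 * `|h|.
    by near: h; exact: HPsi.
  have : k * `|h| * `|h| <= e / 2 * `|h| by rewrite ler_wpM2r.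
  rewrite /k; move: (`|_ - _ - _|) => N.
  have -> : 2 * (N + T * (C * (B * `|h|) ^+ 2)) = 2 * N + 2 * T * C * B ^+ 2 * `|h| * `|h|.
    by ring.
  move: (2 * T * C * B ^+ 2 * `|h| * `|h|) (`|h|) => Q H; lra.
have YPsi : integral_curve_on T Y (Psi ^~ (Phi t0 q)).
  by apply: integral_curveW; case: (gY (Phi t0 q)).
apply: (integral_curve_on_unique lY Yc YPsi _ sT).
by have [_ ->] := gY q; have [_ ->] := gY (Phi t0 q).
Unshelve. all: by end_near. Qed.

End FlowEstimates.

Section AutomorphismFlows.
Variables (R : realType) (d : nat) (G : lieGroupType R d).
Implicit Types (X Y A B : field_coords G) (a b : chart R d G) (p q : G).

(** The flow of a linear field, with the regularity that sums of commuting
    fields visibly inherit. *)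
Definition automorphism_flow (Phi : R -> G -> G) A := [/\ lipschitz_field A,
  generates Phi A, forall s t p, Phi (s + t) p = Phi s (Phi t p),
  forall t, {morph Phi t : x y / (x * y)%g} & forall t, continuous (Phi t)].

Lemma linear_field_flow X : linear_field X -> automorphism_flow (flow X) X.
Proof.
move=> [vX cX [aut f0 fD]].
have lX := vector_field_lipschitz vX.
split => //.
- by move=> p; exact: complete_flow.
- by move=> s t p; rewrite fD.
- by move=> t; case: (aut t).
- by move=> t; case: (aut t) => _ [].
Qed.

Lemma automorphism_flow0 :
  automorphism_flow (fun _ p => p) (fun (_ : chart R d G) (_ : G) => 0).
Proof.
split => //; last by move=> t p; exact: cvg_id.
- exact: lipschitz_field0.
- move=> p; split => //; split; first by move=> t; exact: cvg_cst.
  by move=> t a _ _; exact: is_derive_cst.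
Qed.

Lemma is_derive_rescale (V : normedModType R) (f : R -> V) (k t : R) (v : V) :
  is_derive (k * t) (1 : R) f v -> is_derive t (1 : R) (fun s => f (k * s)) (k *: v).
Proof.
move=> [df Df].
have Dk : is_derive t (1 : R) (fun s : R => k * s) k.
  have -> : (fun s : R => k * s) = (fun s : R => s *: (k : R)).
    by apply/funext => s; rewrite [RHS]mulrC.
  exact: is_derive_line0.
have /derivable1_diffP dfd := df.
have := is_derive_comp_diff Dk dfd.
suff -> : 'd f (k * t) k = k *: v by [].
by rewrite -Df deriveE// -linearZ/= [k *: 1]mulr1.
Qed.

Lemma integral_curve_rescale X c (k : R) : integral_curve X c ->
  integral_curve (fun a p => k *: X a p) (fun t => c (k * t)).
Proof.
move=> [cc D]; split.
  move=> t; apply: (@continuous_comp _ _ _ (fun s => k * s) c); last exact: cc.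
  by apply: cvgMr; exact: cvg_id.
by move=> t a aa ac; apply: (@is_derive_rescale _ (cmap a \o c)); exact: D.
Qed.

Lemma automorphism_flowZ (Phi : R -> G -> G) A (k : R) : automorphism_flow Phi A ->
  automorphism_flow (fun t => Phi (k * t)) (fun a p => k *: A a p).
Proof.
move=> [lA gA PD Pm Pc]; split => //.
- exact: lipschitz_fieldZ.
- move=> p; have [iP P0] := gA p; split; last by rewrite mulr0.
  exact: (@integral_curve_rescale _ (Phi ^~ p)).
- by move=> s t p; rewrite mulrDr PD.
Qed.

(** At time 0 the velocity of Phi t (Psi t q) is A + B by velocity_flow_along;
    the group law reduces the other times to this one. *)
Lemma automorphism_flowD (Phi Psi : R -> G -> G) A B :
  automorphism_flow Phi A -> automorphism_flow Psi B ->
  (forall s t p, Phi s (Psi t p) = Psi t (Phi s p)) ->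
  automorphism_flow (fun t p => Phi t (Psi t p)) (fun a p => A a p + B a p).
Proof.
move=> [lA gA PD Pm Pc] [lB gB QD Qm Qc] PQ.
have D s t p : Phi (s + t) (Psi (s + t) p) = Phi s (Psi s (Phi t (Psi t p))).
  by rewrite PD QD -PQ (PQ t).
split.
- exact: lipschitz_fieldD.
- move=> p; split; last by have [_ ->] := gB p; have [_ ->] := gA p.
  apply/integral_curveE => t; set q := Phi t (Psi t p).
  have [/integral_curveE/(_ 0) vB B0] := gB q.
  have V := velocity_flow_along lA gA vB.
  have -> : (fun t => Phi t (Psi t p)) =
      (fun s => (fun u => Phi u (Psi u q)) (- t + s)).
    by apply/funext => s; rewrite -D addrAC addNr add0r.
  apply: (@velocity_translate _ _ _ _ (fun u => Phi u (Psi u q))).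
  by rewrite addNr; move: V; rewrite B0.
- exact: D.
- by move=> t x y; rewrite Qm Pm.
- by move=> t p; apply: continuous_comp; [exact: Qc|exact: Pc].
Qed.

Lemma automorphism_flow1 (Phi : R -> G -> G) A t : automorphism_flow Phi A ->
  Phi t 1%g = 1%g.
Proof.
move=> [_ _ _ Pm _].
by have := Pm t 1%g 1%g; rewrite mul1g => /(congr1 (fun z => (Phi t 1)^-1 * z)%g);
  rewrite mulVg mulKg.
Qed.

Lemma mulg_left_continuous p : continuous (fun q : G => (p * q)%g).
Proof.
move=> q; apply: (@continuous_comp _ _ _ (fun q : G => (p, q)) (fun z : G * G => (z.1 * z.2)%g)).
  by apply: cvg_pair; [exact: cvg_cst|exact: cvg_id].
exact: lie_mul_continuous.
Qed.

Lemma mulg_right_continuous p : continuous (fun q : G => (q * p)%g).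
Proof.
move=> q; apply: (@continuous_comp _ _ _ (fun q : G => (q, p)) (fun z : G * G => (z.1 * z.2)%g)).
  by apply: cvg_pair; [exact: cvg_id|exact: cvg_cst].
exact: lie_mul_continuous.
Qed.

(** H is open, as a union of translates of a neighborhood V of 1 contained in
    H, and so is its complement, which is stable by translation by V^-1. *)
Lemma connected_group_generated (H : set G) : connected [set: G] ->
  (forall p q, H p -> H q -> H (p * q)%g) -> nbhs 1%g H -> forall p, H p.
Proof.
move=> conn HM H1 p.
pose V := [set v : G | H v /\ H (v^-1)%g].
have V1 : nbhs 1%g V.
  apply: filterI => //.
  by have := @lie_inv_continuous _ _ G 1%g; rewrite /continuous_at invg1; apply.
have VH (x v : G) : V v -> H x <-> H (x * v)%g.
  move=> [Hv Hv']; split => [Hx|Hxv]; first exact: HM.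
  by rewrite -(mulgK v x); exact: HM.
have nb (x : G) : \forall y \near x, V (x^-1 * y)%g.
  by have := @mulg_left_continuous x^-1%g x; rewrite /continuous_at mulVg; apply.
suff E : H = [set: G] by rewrite E.
apply: conn.
- by exists 1%g; exact: nbhs_singleton H1.
- exists H; last by rewrite setTI.
  rewrite openE => x Hx; have := nb x; apply: filterS => y Vy.
  by rewrite -(mulVKg x y); apply/(VH x _ Vy).
- exists H; last by rewrite setTI.
  rewrite -openC openE => x Hx; have := nb x; apply: filterS => y Vy /= Hy.
  by apply: Hx; apply/(VH x _ Vy); rewrite mulVKg.
Qed.

(** Commutation for short times near 1 extends to the group because the flows
    act by automorphisms, and to all times by iteration. *)
Lemma commuting_automorphism_flows (Phi Psi : R -> G -> G) X Y : connected [set: G] ->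
  vector_field X -> vector_field Y -> fields_commute X Y ->
  automorphism_flow Phi X -> automorphism_flow Psi Y ->
  forall s t p, Phi s (Psi t p) = Psi t (Phi s p).
Proof.
move=> conn vX vY cXY [lX gX PD Pm Pc] [lY gY QD Qm Qc].
have [a aa a1] := atlas_cover (1%g : G).
have [T [r [T0 r0 H]]] := commuting_fields_flows vX vY cXY gX gY Pc aa a1.
(* The points at which the two automorphisms commute form a subgroup. *)
have small s t p : `|s| < T -> `|t| < T -> Phi t (Psi s p) = Psi s (Phi t p).
  move=> sT tT; move: p.
  apply: (@connected_group_generated [set p | Phi t (Psi s p) = Psi s (Phi t p)]) => //.
    by move=> p q /= Ep Eq; rewrite Qm Pm Ep Eq Pm Qm.
  near=> p; apply: H => //; near: p; first exact: near_cdom.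
  exact: near_cmap.
have P0 p : Phi 0 p = p by case: (gX p).
have Q0 p : Psi 0 p = p by case: (gY p).
have iterP n s t p : (forall p, Phi s (Psi t p) = Psi t (Phi s p)) ->
    Phi (s *+ n) (Psi t p) = Psi t (Phi (s *+ n) p).
  move=> E; elim: n => [|n IH]; first by rewrite mulr0n !P0.
  by rewrite mulrS !PD IH E.
have iterQ n s t p : (forall p, Phi s (Psi t p) = Psi t (Phi s p)) ->
    Phi s (Psi (t *+ n) p) = Psi (t *+ n) (Phi s p).
  move=> E; elim: n => [|n IH]; first by rewrite mulr0n !Q0.
  by rewrite mulrS !QD E IH.
move=> s t p.
have [n sn] : exists n, `|s| + `|t| < T *+ n.+1.
  have := archi_boundP (_ : 0 <= (`|s| + `|t|) / T).
  rewrite divr_ge0 ?addr_ge0 ?(ltW T0)// => /(_ isT).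
  set n := Num.bound _; rewrite ltr_pdivrMr// mulr_natl => lt.
  by exists n; rewrite mulrS (lt_trans lt)// ltrDr.
have part z : `|z| <= `|s| + `|t| -> `|z / n.+1%:R| < T.
  move=> zst; rewrite normrM normfV [`|n.+1%:R|]ger0_norm// ltr_pdivrMr ?ltr0n//.
  by rewrite mulr_natr (le_lt_trans zst).
have sE : s = s / n.+1%:R *+ n.+1 by rewrite -mulr_natr divfK// pnatr_eq0.
have tE : t = t / n.+1%:R *+ n.+1 by rewrite -mulr_natr divfK// pnatr_eq0.
rewrite sE tE; apply: iterP => {}p; apply: iterQ => {}p.
by apply: small; apply: part; rewrite ?lerDl ?lerDr.
Unshelve. all: by end_near. Qed.

End AutomorphismFlows.

(** * Solutions of affine equations on Lie groups *)

Section CocycleExtension.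
Variables (R : realType) (G : groupType) (rho : R -> G -> G).
Hypothesis rhoD : forall s t p, rho (s + t) p = rho s (rho t p).
Hypothesis rhoM : forall t, {morph rho t : x y / (x * y)%g}.

Definition cocycle_on (T : R) (phi : R -> G) :=
  forall s t, `|s| + `|t| < T -> phi (s + t) = (phi s * rho s (phi t))%g.

Definition double (phi : R -> G) (t : R) : G :=
  let h := t / 2 in (phi h * rho h (phi h))%g.

Lemma half_norm_sum (t : R) : `|t / 2| + `|t / 2| = `|t|.
Proof. by rewrite normrM normfV [`|2|]ger0_norm// -splitr. Qed.

Lemma double_id T phi t : cocycle_on T phi -> `|t| < T -> double phi t = phi t.
Proof. by move=> H tT; rewrite /double -H -?splitr// half_norm_sum. Qed.

(** (phi t, t) is a local one-parameter group of the semidirect product of G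
    and R, in which the square of a product of commuting elements is the
    product of their squares. *)
Lemma cocycle_double T phi : cocycle_on T phi -> cocycle_on (T *+ 2) (double phi).
Proof.
move=> H s t st; rewrite /double mulrDl.
set a := s / 2; set b := t / 2.
have ab : `|a| + `|b| < T.
  rewrite /a /b !normrM normfV [`|2|]ger0_norm// -mulrDl ltr_pdivrMr//.
  by rewrite mulr_natr.
have ba : `|b| + `|a| < T by rewrite addrC.
have -> : rho s (phi b * rho b (phi b))%g = rho a (rho a (phi b * rho b (phi b)))%g.
  by rewrite -rhoD -splitr.
have E x : (phi a * rho a (phi b * rho b x))%g = (phi (a + b) * rho (a + b) x)%g.
  by rewrite rhoM mulgA -H// -rhoD.
have E' x : (phi b * rho b (phi a * rho a x))%g = (phi (a + b) * rho (a + b) x)%g.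
  by rewrite rhoM mulgA -H// -rhoD addrC.
transitivity (phi a * rho a (phi a * rho a (phi b * rho b (phi b))))%g; last first.
  by rewrite [in LHS]rhoM mulgA.
by rewrite E -(E' (phi b)) E -(H a b ab).
Qed.

Lemma cocycle_extension (T : R) (phi0 : R -> G) : 0 < T -> cocycle_on T phi0 ->
  exists phi : R -> G, (forall s t, phi (s + t) = (phi s * rho s (phi t))%g) /\
    forall t, `|t| < T -> phi t = phi0 t.
Proof.
move=> T0 H0.
pose f n := iter n double phi0.
pose Tn n := iter n (fun x => x *+ 2) T.
have fH n : cocycle_on (Tn n) (f n) by elim: n => //= n; exact: cocycle_double.
have Tn_ge n : T *+ n <= Tn n /\ T <= Tn n.
  elim: n => [|n [IH1 IH2]]; first by rewrite mulr0n ltW.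
  rewrite /= mulr2n; split; first by rewrite mulrSr lerD.
  by rewrite (le_trans IH2)// lerDl (le_trans _ IH2)// ltW.
have Tn_step n : Tn n <= Tn n.+1.
  by rewrite /= mulr2n lerDl (le_trans (ltW T0))//; case: (Tn_ge n).
have stable n k t : `|t| < Tn n -> f (n + k)%N t = f n t /\ `|t| < Tn (n + k)%N.
  move=> tn; elim: k => [|k [IH1 IH2]]; first by rewrite addn0.
  rewrite addnS; split; last by rewrite (lt_le_trans IH2).
  by rewrite -IH1; exact: double_id (fH (n + k)%N) IH2.
have big (t : R) : exists n, `|t| < Tn n.
  have := archi_boundP (_ : 0 <= `|t| / T).
  rewrite divr_ge0 ?(ltW T0)// => /(_ isT); set n := Num.bound _.
  rewrite ltr_pdivrMr// mulr_natl => lt; exists n; rewrite (lt_le_trans lt)//.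
  by case: (Tn_ge n).
have [N HN] := choice big.
have fN n t : `|t| < Tn n -> f (N t) t = f n t.
  move=> tn; have [<- _] := stable _ n _ (HN t).
  by rewrite addnC; have [] := stable _ (N t) _ tn.
exists (fun t => f (N t) t); split; last by move=> t tT; rewrite (fN 0%N).
move=> s t; have [n] := big (`|s| + `|t|).
rewrite ger0_norm ?addr_ge0// => stn.
have sn : `|s| < Tn n by rewrite (le_lt_trans _ stn)// lerDl.
have tn : `|t| < Tn n by rewrite (le_lt_trans _ stn)// lerDr.
rewrite !(fN n)//; first exact: fH.
exact: le_lt_trans (ler_normD _ _) stn.
Qed.

End CocycleExtension.

Section Products.
Variables (R : realType) (d : nat) (G : lieGroupType R d).
Implicit Types (X Y A B : field_coords G) (a b c : chart R d G) (p q : G).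

Definition mul_chart a b c (x : 'rV[R]_d * 'rV[R]_d) :=
  cmap c (cinv a x.1 * cinv b x.2)%g.

Lemma mul_chart_differentiable a b c p q : atlas a -> atlas b -> atlas c ->
  cdom a p -> cdom b q -> cdom c (p * q)%g ->
  differentiable (mul_chart a b c) (cmap a p, cmap b q).
Proof.
move=> aa ab ac ap bq cpq.
by apply: (@lie_mul_smooth _ _ G a b c aa ab ac [::]); exists (p, q).
Qed.

Lemma tangent_right_translation a b c p q v : atlas a -> atlas b -> atlas c ->
  cdom a p -> cdom b q -> cdom c (p * q)%g ->
  tangent_map (fun x : G => (x * q)%g) a c p v =
  'd (mul_chart a b c) (cmap a p, cmap b q) (v, 0).
Proof.
move=> aa ab ac ap bq cpq.
have dm := mul_chart_differentiable aa ab ac ap bq cpq.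
rewrite /tangent_map.
have -> : cmap c \o (fun x : G => (x * q)%g) \o cinv a =
    mul_chart a b c \o (fun x => (x, cmap b q)).
  by apply/funext => x; rewrite /mul_chart /= cmapK.
pose k (x : 'rV[R]_d) := (x, cmap b q).
have dk : is_diff (cmap a p) k (fun v : 'rV[R]_d => (v, 0 : 'rV[R]_d)).
  exact: (is_diff_pair (is_diff_id _) (is_diff_cst _ _)).
have dkx : differentiable k (cmap a p) by exact: ex_diff.
rewrite (diff_comp dkx dm).
by rewrite [LHS]/comp (diff_val (f := k)).
Qed.

Lemma is_derive_mul (f g : R -> G) (t : R) a b c v w : atlas a -> atlas b -> atlas c ->
  cdom a (f t) -> cdom b (g t) -> cdom c (f t * g t)%g ->
  {for t, continuous f} -> {for t, continuous g} ->
  is_derive t (1 : R) (cmap a \o f) v -> is_derive t (1 : R) (cmap b \o g) w ->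
  is_derive t (1 : R) (fun s => cmap c (f s * g s)%g)
    ('d (mul_chart a b c) (cmap a (f t), cmap b (g t)) (v, w)).
Proof.
move=> aa ab ac af bg cfg cf cg Df Dg.
have dm := mul_chart_differentiable aa ab ac af bg cfg.
have := is_derive_comp_diff (is_derive_pair Df Dg) dm.
apply: near_eq_is_derive; near=> s.
by rewrite /mul_chart /= !cmapK//; near: s; [exact: (cg _ (near_cdom bg))|
  exact: (cf _ (near_cdom af))].
Unshelve. all: by end_near. Qed.

Lemma mulg_curve_continuous (f g : R -> G) t :
  {for t, continuous f} -> {for t, continuous g} ->
  {for t, continuous (fun s => (f s * g s)%g)}.
Proof.
move=> cf cg.
apply: (@continuous_comp _ _ _ (fun s => (f s, g s)) (fun z : G * G => (z.1 * z.2)%g)).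
  exact: cvg_pair.
exact: lie_mul_continuous.
Qed.

(** Right invariance, with smoothness weakened as in lipschitz_field. *)
Definition invariant_field Y := lipschitz_field Y /\
  forall (g h : G) a b, atlas a -> atlas b -> cdom a g -> cdom b (g * h)%g ->
    Y b (g * h)%g = tangent_map (fun x : G => (x * h)%g) a b g (Y a g).

Lemma invariant_fieldZ k Y : invariant_field Y -> invariant_field (fun a p => k *: Y a p).
Proof.
move=> [lY iY]; split; first exact: lipschitz_fieldZ.
by move=> g h a b aa ab ag bgh; rewrite (iY g h a b)// /tangent_map linearZ.
Qed.

Lemma invariant_field_sum (n : nat) (Y : 'I_n -> field_coords G) :
  (forall i, invariant_field (Y i)) -> invariant_field (fun a p => \sum_i Y i a p).
Proof.
elim: n Y => [|n IH] Y iY.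
  have -> : (fun a p => \sum_(i < 0) Y i a p) = (fun _ _ => 0).
    by apply/funext => a; apply/funext => p; rewrite big_ord0.
  split; first exact: lipschitz_field0.
  by move=> g h a b _ _ _ _; rewrite /tangent_map linear0.
have [lS iS] := IH (fun i => Y (lift ord0 i)) (fun i => iY _).
have [l0 i0] := iY ord0.
have -> : (fun a p => \sum_(i < n.+1) Y i a p) =
    (fun a p => Y ord0 a p + \sum_(i < n) Y (lift ord0 i) a p).
  by apply/funext => a; apply/funext => p; rewrite big_ord_recl.
split; first exact: lipschitz_fieldD.
by move=> g h a b aa ab ag bgh; rewrite (i0 g h a b)// (iS g h a b)// /tangent_map linearD.
Qed.

(** The translation part comes from the invariance of Y. The part of A comes
    from differentiating rho s (g h) = rho s g * rho s h at s = 0. *)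
Lemma velocity_mul_orbit (rho : R -> G -> G) A Y (f g : R -> G) t :
  automorphism_flow rho A -> invariant_field Y ->
  velocity (fun a => A a (f t) + Y a (f t)) f t -> velocity (A ^~ (g t)) g t ->
  velocity (fun a => A a (f t * g t)%g + Y a (f t * g t)%g) (fun s => (f s * g s)%g) t.
Proof.
move=> [lA gA _ rM _] [lY iY] [cf Df] [cg Dg].
split; first exact: mulg_curve_continuous.
move=> c ac cfg.
have [a aa af] := atlas_cover (f t); have [b ab bg] := atlas_cover (g t).
have D := is_derive_mul aa ab ac af bg cfg cf cg (Df a aa af) (Dg b ab bg).
suff <- : 'd (mul_chart a b c) (cmap a (f t), cmap b (g t))
    (A a (f t) + Y a (f t), A b (g t)) = A c (f t * g t)%g + Y c (f t * g t)%g by [].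
have -> : (A a (f t) + Y a (f t), A b (g t)) =
    (A a (f t), A b (g t)) + (Y a (f t), 0) :> 'rV[R]_d * 'rV[R]_d.
  by apply/pair_equal_spec; rewrite /= addr0.
rewrite linearD/= -(tangent_right_translation _ aa ab ac af bg cfg) -(iY _ _ a c)//.
congr (_ + _).
(* What remains is the velocity of rho s (f t) * rho s (g t) at s = 0. *)
have [[cF DF] F0] := gA (f t); have [[cH DH] H0] := gA (g t).
have [[cP DP] P0] := gA (f t * g t)%g.
have DF' := DF 0 a aa; have DH' := DH 0 b ab; have DP' := DP 0 c ac.
rewrite F0 in DF'; rewrite H0 in DH'; rewrite P0 in DP'.
have := @is_derive_mul (rho ^~ (f t)) (rho ^~ (g t)) 0 a b c (A a (f t)) (A b (g t)) aa ab ac.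
rewrite F0 H0 => /(_ af bg cfg (cF 0) (cH 0) (DF' af) (DH' bg)) D0.
apply: is_derive_unique D0 _.
have := DP' cfg.
by have -> : cmap c \o rho^~ (f t * g t)%g = (fun s => cmap c (rho s (f t) * rho s (g t))%g)
  by apply/funext => s; rewrite /= rM.
Qed.

Lemma velocity_near_eq (v : chart R d G -> 'rV[R]_d) (f g : R -> G) t :
  (\forall s \near t, f s = g s) -> velocity v f t -> velocity v g t.
Proof.
move=> fg [cf Df]; have fgt := nbhs_singleton fg; split.
  rewrite /prop_for /continuous_at -fgt.
  by apply: cvg_trans cf; apply: near_eq_cvg.
move=> a aa ag; rewrite -fgt in ag; have := Df a aa ag.
by apply: near_eq_is_derive; apply: filterS fg => s /= ->.
Qed.

(** The local solution from 1 is a cocycle by uniqueness, hence extends to all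
    times; the extension is a solution by translating the velocity at 0. *)
Lemma affine_solution (rho : R -> G -> G) A Y :
  automorphism_flow rho A -> invariant_field Y ->
  exists phi : R -> G, [/\ integral_curve (fun a p => A a p + Y a p) phi, phi 0 = 1%g &
    forall s t, phi (s + t) = (phi s * rho s (phi t))%g].
Proof.
move=> rA iY; have [lA gA rD rM rc] := rA; have [lY _] := iY.
have lZ := lipschitz_fieldD lA lY.
have [a aa a1] := atlas_cover (1%g : G).
have [T [r [T0 r0 H]]] := local_integral_curves lZ aa a1 (@ltr01 R).
have [f [[cf Vf] f0 _]] : exists e : R -> G,
    [/\ integral_curve_on T (fun a p => A a p + Y a p) e, e 0 = 1%g &
    forall t, cdom a (e t) /\ `|cmap a (e t) - cmap a 1%g| < 1].
  by apply: H; rewrite ?subrr ?normr0.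
have fc : cocycle_on rho T f.
  move=> s h sh; have sT : `|s| < T - `|h| by rewrite ltrBrDr.
  have hT : `|h| < T by rewrite (le_lt_trans _ sh)// lerDr.
  rewrite [in LHS]addrC; pose c1 u := f (h + u); pose c2 u := (f u * rho u (f h))%g.
  have [[ch Vh] r0h] := gA (f h).
  apply: (@integral_curve_on_unique _ _ _ (T - `|h|) _ c1 c2 lZ _ _ _ _ sT).
  - split.
      move=> u; apply: (@continuous_comp _ _ _ (fun u => h + u) f); last exact: cf.
      by apply: cvgD; [exact: cvg_cst|exact: cvg_id].
    move=> u uT; apply: velocity_translate; apply: Vf.
    by rewrite (le_lt_trans (ler_normD _ _))// addrC -ltrBrDr.
  - split; first by move=> u; apply: mulg_curve_continuous; [exact: cf|exact: ch].
    move=> u uT; apply: (velocity_mul_orbit rA iY).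
      by apply: Vf; rewrite (lt_le_trans uT)// lerBlDr lerDl.
    by split; [exact: ch|exact: Vh].
  - by rewrite /c1 /c2 addr0 f0 mul1g r0h.
have [phi [phiD phif]] := cocycle_extension rD rM T0 fc.
have phi0 : phi 0 = 1%g by rewrite phif ?normr0.
exists phi; split => //.
have V0 : velocity (fun a => A a (phi 0) + Y a (phi 0)) phi 0.
  have f0T : `|(0 : R)| < T by rewrite normr0.
  have := Vf 0 f0T; rewrite f0 -phi0; apply: velocity_near_eq.
  by near=> s; rewrite phif//; near: s; exact: near_abs_lt.
apply/integral_curveE => t.
have -> : phi = (fun s => (fun h => (phi h * rho h (phi t))%g) (- t + s)).
  by apply/funext => s; rewrite -phiD addrAC addNr add0r.
apply: (@velocity_translate _ _ _ _ (fun h => (phi h * rho h (phi t))%g)).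
rewrite addNr phi0 mul1g; have [[ct Vt] r0t] := gA (phi t).
have := velocity_mul_orbit rA iY V0 (conj (ct 0) (Vt 0)).
by rewrite phi0 mul1g.
Unshelve. all: by end_near. Qed.

End Products.

(** * Convergence of the product *)

Section Trotter.
Variables (R : realType) (d : nat) (G : lieGroupType R d).
Implicit Types (X Y A B : field_coords G) (a b c : chart R d G) (p q : G).

Definition dist1 a p := `|cmap a p - cmap a 1%g|.

Definition mul_lipschitz_near a (K r : R) :=
  forall p q p' q', cdom a p -> cdom a q -> cdom a p' -> cdom a q' ->
    dist1 a p < r -> dist1 a q < r -> dist1 a p' < r -> dist1 a q' < r ->
    cdom a (p * q)%g /\ `|cmap a (p * q)%g - cmap a (p' * q')%g| <=
      K * Num.max `|cmap a p - cmap a p'| `|cmap a q - cmap a q'|.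

(** Multiplication is smooth in the product chart around (1, 1). *)
Lemma mul_lipschitz a : atlas a -> cdom a 1%g ->
  exists K r, [/\ 1 <= K, 0 < r & mul_lipschitz_near a K r].
Proof.
move=> aa a1; pose x1 := cmap a (1%g : G).
have sm := @lie_mul_smooth _ _ G a a a aa aa aa; set U := (X in smooth_on X _) in sm.
have U1 : nbhs (x1, x1) U.
  have ci : {for x1, continuous (cinv a)} by apply: cinv_continuous; exists 1%g.
  have i1 : cinv a x1 = 1%g by exact: cmapK.
  have near_i : \forall x \near x1, (cmap a @` cdom a) x by exact: nbhs_cimg.
  have cm : {for (x1, x1),
      continuous (fun x : 'rV[R]_d * 'rV[R]_d => (cinv a x.1 * cinv a x.2)%g)}.
    have c1 : {for (x1, x1), continuous (cinv a \o (@fst 'rV[R]_d 'rV[R]_d))}.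
      by apply: continuous_comp; [exact: cvg_fst|exact: ci].
    have c2 : {for (x1, x1), continuous (cinv a \o (@snd 'rV[R]_d 'rV[R]_d))}.
      by apply: continuous_comp; [exact: cvg_snd|exact: ci].
    apply: (@continuous_comp _ _ _ (fun x : 'rV[R]_d * 'rV[R]_d => (cinv a x.1, cinv a x.2))
      (fun z : G * G => (z.1 * z.2)%g)); last exact: lie_mul_continuous.
    exact: cvg_pair.
  have n1 : \forall x \near (x1, x1), (cmap a @` cdom a) x.1 by exact: cvg_fst near_i.
  have n2 : \forall x \near (x1, x1), (cmap a @` cdom a) x.2 by exact: cvg_snd near_i.
  have n3 : \forall x \near (x1, x1), cdom a (cinv a x.1 * cinv a x.2)%g.
    by have := cm (cdom a); rewrite /= i1 mul1g; apply; exact: near_cdom.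
  near=> x.
  have /cinv_image[d1 e1] : (cmap a @` cdom a) x.1 by near: x.
  have /cinv_image[d2 e2] : (cmap a @` cdom a) x.2 by near: x.
  have d3 : cdom a (cinv a x.1 * cinv a x.2)%g by near: x.
  by exists (cinv a x.1, cinv a x.2) => //=; rewrite e1 e2; case: (x).
have [K [r [K0 r0 Ur Kl]]] :=
  smooth_lipschitz (frame_pair (@frame_row R d) (@frame_row R d)) U1 sm.
exists (K + 1), r; split => //; first by rewrite lerDr.
move=> p q p' q' ap aq ap' aq' pr qr p'r q'r.
have in_r z w : dist1 a z < r -> dist1 a w < r -> `|(cmap a z, cmap a w) - (x1, x1)| < r.
  by move=> zr wr; rewrite prod_normE/= gt_max zr.
(* The points of the ball are coordinates of pairs whose product lies in the
   domain of a, and p, q are recovered from theirs. *)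
have := Ur _ (in_r _ _ pr qr).
move=> [[z w] /= [az aw azw]] /pair_equal_spec[E1 E2].
have zE : z = p by rewrite -(cmapK az) E1 cmapK.
have wE : w = q by rewrite -(cmapK aw) E2 cmapK.
rewrite zE wE in azw; split => //.
have := Kl _ _ (in_r _ _ p'r q'r) (in_r _ _ pr qr).
rewrite /= !cmapK// prod_normE/= => /le_trans; apply.
by rewrite ler_wpM2r// ?lerDl// le_max normr_ge0.
Unshelve. all: by end_near. Qed.

Section NearIdentity.
Variables (a : chart R d G) (K r : R).
Hypotheses (aa : atlas a) (a1 : cdom a 1%g) (K1 : 1 <= K) (r0 : 0 < r).
Hypothesis Klip : mul_lipschitz_near a K r.

Let K0 : 0 <= K. Proof. by rewrite (le_trans _ K1). Qed.

Lemma dist11 : dist1 a 1%g = 0. Proof. by rewrite /dist1 subrr normr0. Qed.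

Lemma dist1_mul p q : cdom a p -> cdom a q -> dist1 a p < r -> dist1 a q < r ->
  cdom a (p * q)%g /\ `|cmap a (p * q)%g - cmap a p| <= K * dist1 a q.
Proof.
move=> ap aq pr qr; have := @Klip p q p 1%g ap aq ap a1 pr qr pr.
by rewrite dist11 mulg1 subrr normr0 (max_idPr _)// => /(_ r0).
Qed.

Lemma dist1_divide p q : cdom a p -> cdom a q -> cdom a (q^-1)%g ->
  dist1 a p < r -> dist1 a q < r -> dist1 a (q^-1)%g < r ->
  cdom a (p * q^-1)%g /\ dist1 a (p * q^-1)%g <= K * `|cmap a p - cmap a q|.
Proof.
move=> ap aq aq' pr qr qr'; have := @Klip p (q^-1)%g q (q^-1)%g ap aq' aq aq' pr qr' qr qr'.
by rewrite mulgV subrr normr0 (max_idPl _).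
Qed.

(** A factor f i moves a point near 1 by at most K dist1 (f i), so that the
    distances add up. *)
Lemma dist1_prod (n : nat) (f : nat -> G) (e : R) :
  (forall i, (i < n)%N -> cdom a (f i) /\ dist1 a (f i) <= e) -> 0 <= e ->
  n%:R * (K * e) < r -> e < r ->
  cdom a (\prod_(i < n) f i)%g /\ dist1 a (\prod_(i < n) f i)%g <= n%:R * (K * e).
Proof.
move=> H e0 + er; have Ke0 : 0 <= K * e by rewrite mulr_ge0.
elim: n H => [|n IH] H nr; first by rewrite big_ord0 dist11 mul0r.
have nr' : n%:R * (K * e) < r.
  by rewrite (le_lt_trans _ nr)// ler_wpM2r// ler_nat.
have [ap pr] := IH (fun i lin => H i (ltnW lin)) nr'.
have [af fe] := H n (ltnSn n).
rewrite big_ord_recr/=.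
have [apf pf] := dist1_mul ap af (le_lt_trans pr nr') (le_lt_trans fe er).
split => //; rewrite /dist1 (le_trans (ler_distD (cmap a (\prod_(i < n) f i)%g) _ _))//.
rewrite -natr1 mulrDl mul1r addrC lerD// (le_trans pf)//.
by rewrite ler_wpM2l.
Qed.

Lemma automorphism_flow_fixed (rho : R -> G -> G) A : automorphism_flow rho A ->
  A a 1%g = 0.
Proof.
move=> rA; have [_ gA _ _ _] := rA.
have a1' : cdom a (rho 0 1%g) by case: (gA 1%g) => _ ->.
have := flow_derive gA aa a1'; have [_ ->] := gA 1%g.
have -> : (fun s => cmap a (rho s 1%g)) = cst (cmap a 1%g).
  by apply/funext => s; rewrite (automorphism_flow1 _ rA).
by move=> /is_derive_unique/(_ (is_derive_cst _ _ _)).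
Qed.

(** Gronwall at the fixed point 1 of the flow. *)
Lemma automorphism_flow_dist1 (rho : R -> G -> G) A : automorphism_flow rho A ->
  exists T s, [/\ 0 < T, 0 < s & forall p t, cdom a p -> dist1 a p < s -> `|t| < T ->
    cdom a (rho t p) /\ dist1 a (rho t p) <= 2 * dist1 a p].
Proof.
move=> rA; have [lA gA _ _ _] := rA.
have A1 := automorphism_flow_fixed rA.
have [L [s1 [L0 s10 _ iL]]] := lA.2 a _ aa a1.
have [T1 [s [T10 s0 H]]] := flow_stays_near lA gA aa a1 s10.
have L1 : 0 < 2 * L + 1 by rewrite ltr_wpDl// mulr_ge0.
pose T := Num.min T1 (2 * L + 1)^-1.
have T0 : 0 < T by rewrite lt_min T10 invr_gt0.
have LT : L * T <= 2^-1.
  have T3 : T <= (2 * L + 1)^-1 by rewrite ge_min lexx orbT.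
  rewrite (le_trans (ler_wpM2l L0 T3))// ler_pdivrMr//; lra.
exists T, s; split => // p t ap ps tT.
have HT u : `|u| < T -> cdom a (rho u p) /\ `|cmap a (rho u p) - cmap a 1%g| < s1.
  by rewrite lt_min => /andP[uT _]; exact: H.
split; first by case: (HT t tT).
have DF u : `|u| < T ->
    is_derive u (1 : R) (fun u => cmap a (rho u p) - cmap a 1%g) (A a (rho u p) - 0).
  by move=> /HT[au _]; apply: is_deriveB; exact: flow_derive.
have BF u : `|u| < T -> `|A a (rho u p) - 0| <= L * `|cmap a (rho u p) - cmap a 1%g| + 0.
  move=> /HT[au us]; have := iL (cmap a 1%g) (cmap a (rho u p)).
  by rewrite subrr normr0 !cmapK// A1 addr0; apply.
have := short_gronwall L0 (lexx 0) LT DF BF tT.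
by have [_ ->] := gA p; rewrite mulr0 addr0.
Qed.

Section Perturbation.
Variables (rho : R -> G -> G) (A Y : field_coords G) (phi eta : R -> G).
Hypotheses (rA : automorphism_flow rho A).
Hypotheses (phi_curve : integral_curve (fun b p => A b p + Y b p) phi) (phi0 : phi 0 = 1%g).
Hypothesis phiD : forall s t, phi (s + t) = (phi s * rho s (phi t))%g.
Hypotheses (eta_curve : integral_curve Y eta) (eta0 : eta 0 = 1%g).

(** The conjugates of the automorphisms rho s by phi s form a one-parameter group
    of automorphisms, by the cocycle identity: the flow of A + Y minus the
    left invariant field equal to Y at 1. *)
Definition twisted_flow (s : R) (x : G) := (phi s * rho s x * (phi s)^-1)%g.

Definition defect (h : R) := (eta h * (phi h)^-1)%g.

Lemma twisted_flowD s t x : twisted_flow (s + t) x = twisted_flow s (twisted_flow t x).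
Proof.
have [_ _ rD rM _] := rA.
have rV u z : rho u (z^-1)%g = ((rho u z)^-1)%g.
  by apply/esym/mulg1_eq; rewrite -rM mulgV (automorphism_flow1 _ rA).
by rewrite /twisted_flow phiD rD !rM rV invgM !mulgA.
Qed.

(** In each factor eta h = defect h * phi h. The values of phi multiply up to
    phi (n h), and moving a defect to the left through the previous ones
    conjugates it. *)
Lemma approximation_product (n : nat) (h : R) :
  (\prod_(i < n) rho (i%:R * h) (eta h))%g =
  (\prod_(i < n) twisted_flow (i%:R * h) (defect h) * phi (n%:R * h))%g.
Proof.
have [_ _ _ rM _] := rA.
elim: n => [|n IH]; first by rewrite !big_ord0 mul0r phi0 mulg1.
rewrite !big_ord_recr/= IH -natr1 mulrDl mul1r phiD /twisted_flow /defect.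
by rewrite -!mulgA mulKg -rM mulgVK.
Qed.

Lemma near0_small (f : R -> G) (s : R) : {for 0, continuous f} -> f 0 = 1%g -> 0 < s ->
  \forall t \near (0 : R), cdom a (f t) /\ dist1 a (f t) < s.
Proof.
move=> cf f0 s0; have c1 : f t @[t --> 0] --> (1%g : G) by rewrite -f0; exact: cf.
near=> t; split; near: t; first exact: (c1 _ (near_cdom a1)).
exact: (c1 _ (near_cmap a1 s0)).
Unshelve. all: by end_near. Qed.

Let cphi : {for 0, continuous phi}. Proof. by case: phi_curve => c _; exact: c. Qed.
Let ceta : {for 0, continuous eta}. Proof. by case: eta_curve => c _; exact: c. Qed.
Let cphiV : {for 0, continuous (fun t => (phi t)^-1%g)}.
Proof. by apply: continuous_comp => //; exact: lie_inv_continuous. Qed.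

(** The product phi t * rho t p * (phi t)^-1 is compared with
    phi t * (phi t)^-1 = 1. *)
Lemma twisted_flow_small_time : exists T C s, [/\ 0 < T, 1 <= C, 0 < s &
  forall t p, `|t| < T -> cdom a p -> dist1 a p < s ->
    cdom a (twisted_flow t p) /\ dist1 a (twisted_flow t p) <= C * dist1 a p].
Proof.
have [T1 [s1 [T10 s10 Hr]]] := automorphism_flow_dist1 rA.
have r2 : 0 < r / 2 by rewrite divr_gt0.
have : \forall t \near (0 : R), (cdom a (phi t) /\ dist1 a (phi t) < r / 2) /\
    (cdom a (phi t)^-1%g /\ dist1 a (phi t)^-1%g < r).
  near=> t; split; near: t; first exact: near0_small.
  by apply: (near0_small (f := fun t => (phi t)^-1%g)) => //; rewrite phi0 invg1.
move=> /nbhs_ballP[T2 /= T20 H2].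
have K4 : 0 < 4 * K by rewrite mulr_gt0// (lt_le_trans _ K1).
exists (Num.min T1 T2), (2 * K * K), (Num.min s1 (r / (4 * K))); split.
- by rewrite lt_min T10.
- have KK : 1 <= K * K by rewrite -[leLHS]mulr1 ler_pM.
  by rewrite -mulrA; lra.
- by rewrite lt_min s10 divr_gt0.
- move=> t p; rewrite lt_min => /andP[tT1 tT2] ap; rewrite lt_min => /andP[ps1 psr].
  have [[af fr] [av vr]] : (cdom a (phi t) /\ dist1 a (phi t) < r / 2) /\
    (cdom a (phi t)^-1%g /\ dist1 a (phi t)^-1%g < r).
    by apply: H2; rewrite -ball_normE/= sub0r normrN.
  have [ar rr] := Hr p t ap ps1 tT1.
  have Kp : K * (2 * dist1 a p) < r / 2.
    by move: psr; rewrite ltr_pdivlMr// => psr; lra.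
  have fr' : dist1 a (phi t) < r by rewrite (lt_trans fr)// ltr_pdivrMr// ltr_pMr// ltr1n.
  have rr' : dist1 a (rho t p) < r.
    rewrite (le_lt_trans rr)// (@lt_trans _ _ (r / 2))//; last first.
      by rewrite ltr_pdivrMr// ltr_pMr// ltr1n.
    by rewrite (le_lt_trans _ Kp)// ler_peMl// mulr_ge0// /dist1.
  have [am ml] := dist1_mul af ar fr' rr'.
  have Kr : K * dist1 a (rho t p) <= K * (2 * dist1 a p) by rewrite ler_wpM2l.
  have mr : dist1 a (phi t * rho t p)%g < r.
    rewrite /dist1 (le_lt_trans (ler_distD (cmap a (phi t)) _ _))// addrC.
    by rewrite (splitr r) ltrD// (le_lt_trans ml)// (le_lt_trans Kr).
  have [at' tl] := dist1_divide am af av mr fr' vr.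
  split => //; apply: (le_trans tl).
  have -> : 2 * K * K * dist1 a p = K * (K * (2 * dist1 a p)) by ring.
  by rewrite ler_wpM2l// (le_trans ml).
Unshelve. all: by end_near. Qed.

(** Iteration of the estimate for short times, which the group law permits. *)
Lemma twisted_flow_dist1 (S : R) : 0 <= S -> exists C s, [/\ 0 < C, 0 < s &
  forall t p, `|t| <= S -> cdom a p -> dist1 a p < s ->
    cdom a (twisted_flow t p) /\ dist1 a (twisted_flow t p) <= C * dist1 a p].
Proof.
move=> S0; have [T [C [s [T0 C1 s0 H]]]] := twisted_flow_small_time.
have C0 : 0 < C by rewrite (lt_le_trans _ C1).
have [n nS] : exists n, S < n.+1%:R * T.
  have := archi_boundP (_ : 0 <= S / T).
  rewrite divr_ge0 ?(ltW T0)// => /(_ isT); set n := Num.bound _.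
  rewrite ltr_pdivrMr// => lt; exists n; rewrite (lt_trans lt)//.
  by rewrite ltr_pM2r// ltr_nat.
exists (C ^+ n.+1), (s / C ^+ n.+1); split.
- exact: exprn_gt0.
- by rewrite divr_gt0// exprn_gt0.
- move=> t p tS ap ps.
  pose h := t / n.+1%:R.
  have hT : `|h| < T.
    rewrite normrM normfV [`|n.+1%:R|]ger0_norm// ltr_pdivrMr ?ltr0n//.
    by rewrite (le_lt_trans tS)// mulrC.
  have ps' : C ^+ n.+1 * dist1 a p < s.
    by rewrite mulrC -ltr_pdivlMr ?exprn_gt0.
  have step k : (k <= n.+1)%N -> cdom a (twisted_flow (k%:R * h) p) /\
      dist1 a (twisted_flow (k%:R * h) p) <= C ^+ k * dist1 a p.
    elim: k => [_|k IH kn].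
      have [_ gA _ _ _] := rA; have [_ P0] := gA p.
      by rewrite mul0r /twisted_flow phi0 P0 mul1g invg1 mulg1 expr0 mul1r.
    have [ak lk] := IH (ltnW kn).
    have lks : dist1 a (twisted_flow (k%:R * h) p) < s.
      rewrite (le_lt_trans lk)// (le_lt_trans _ ps')// ler_wpM2r ?normr_ge0//.
      by rewrite ler_weXn2l// ltnW.
    rewrite -nat1r mulrDl mul1r twisted_flowD.
    have [ak' lk'] := H h _ hT ak lks; split => //.
    by rewrite exprS -mulrA (le_trans lk')// ler_wpM2l// ltW.
  have := step n.+1 (leqnn _).
  by rewrite /h mulrC divfK// pnatr_eq0.
Qed.

(** The two curves have the same velocity at 0, because A vanishes at 1. *)
Lemma defect_small (e : R) : 0 < e ->
  \forall h \near (0 : R), cdom a (defect h) /\ dist1 a (defect h) <= e * `|h|.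
Proof.
move=> e0; have [lA gA _ _ _] := rA.
have A1 := automorphism_flow_fixed rA.
have Kp : 0 < K by rewrite (lt_le_trans _ K1).
have e2 : 0 < e / K / 2 by rewrite !divr_gt0.
have aphi : cdom a (phi 0) by rewrite phi0.
have aeta : cdom a (eta 0) by rewrite eta0.
have [_ Dphi] := phi_curve; have [_ Deta] := eta_curve.
have /is_derive_nearP/(_ _ e2) Hphi := Dphi 0 a aa aphi.
have /is_derive_nearP/(_ _ e2) Heta := Deta 0 a aa aeta.
have S1 := near0_small cphi phi0 r0.
have S2 := near0_small ceta eta0 r0.
have S3 : \forall t \near (0 : R), cdom a (phi t)^-1%g /\ dist1 a (phi t)^-1%g < r.
  by apply: (near0_small (f := fun t => (phi t)^-1%g)) => //; rewrite phi0 invg1.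
near=> h.
have [af fr] : cdom a (phi h) /\ dist1 a (phi h) < r by near: h; exact: S1.
have [ae er] : cdom a (eta h) /\ dist1 a (eta h) < r by near: h; exact: S2.
have [av vr] : cdom a (phi h)^-1%g /\ dist1 a (phi h)^-1%g < r by near: h; exact: S3.
have [ad dl] := dist1_divide ae af av er fr vr; split => //.
rewrite (le_trans dl)// -ler_pdivlMl// mulrA [K^-1 * e]mulrC.
have E1 : `|(cmap a \o phi) (0 + h) - (cmap a \o phi) 0 - h *: (A a (phi 0) + Y a (phi 0))|
    <= e / K / 2 * `|h| by near: h; exact: Hphi.
have E2 : `|(cmap a \o eta) (0 + h) - (cmap a \o eta) 0 - h *: Y a (eta 0)|
    <= e / K / 2 * `|h| by near: h; exact: Heta.
move: E1 E2; rewrite /= !add0r phi0 eta0 A1 add0r => E1 E2.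
have -> : cmap a (eta h) - cmap a (phi h) =
  (cmap a (eta h) - cmap a 1%g - h *: Y a 1%g) -
  (cmap a (phi h) - cmap a 1%g - h *: Y a 1%g).
  have E z : z - cmap a 1%g - h *: Y a 1%g = z + (- cmap a 1%g - h *: Y a 1%g).
    by rewrite addrA.
  by rewrite !E opprD addrACA subrr addr0.
by rewrite (le_trans (ler_normB _ _))// [e / K]splitr mulrDl lerD.
Unshelve. all: by end_near. Qed.

(** The product is phi t up to a product of n terms of size o(1 / n). *)
Lemma approximation_cvg (t : R) :
  (fun n : nat => \prod_(i < n) rho (i%:R * (t / n%:R))%R (eta (t / n%:R)%R))%g @ \oo
    --> phi t.
Proof.
have small : (fun n : nat =>
    \prod_(i < n) twisted_flow (i%:R * (t / n%:R))%R (defect (t / n%:R)%R))%g @ \oo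
    --> (1%g : G).
  move=> U U1; have [r1 r10 HU] := chart_ball_nbhs a1 U1.
  have [C [s [C0 s0 HC]]] := twisted_flow_dist1 (normr_ge0 t).
  pose q := Num.min r r1.
  have q0 : 0 < q by rewrite lt_min r0.
  have Kp : 0 < K by rewrite (lt_le_trans _ K1).
  have t1 : 0 < `|t| + 1 by rewrite ltr_wpDl.
  (* With this e the n defects, of total size at most e |t|, stay within the
     radius s, and their images, inflated by K C, within q. *)
  pose e := Num.min (q / (K * C * (`|t| + 1))) (s / (`|t| + 1)) / 2.
  have den : 0 < K * C * (`|t| + 1) by rewrite !mulr_gt0.
  have e0 : 0 < e by rewrite divr_gt0// lt_min !divr_gt0.
  have cv : t / n%:R @[n --> \oo] --> (0 : R).
    apply/cvgrPdist_lt => z z0; near=> n.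
    have n0 : 0 < (n%:R : R) by rewrite ltr0n; near: n; exists 1%N.
    rewrite sub0r normrN normrM normfV (gtr0_norm n0) ltr_pdivrMr// -ltr_pdivrMl//.
    near: n; exact: nbhs_infty_gtr.
  have near_d := cv _ (defect_small e0).
  change (\forall n \near \oo, U (\prod_(i < n)
    twisted_flow (i%:R * (t / n%:R))%R (defect (t / n%:R)%R))%g).
  near=> n.
  have n0 : (0 < n)%N by near: n; exists 1%N.
  have nR : 0 < (n%:R : R) by rewrite ltr0n.
  have n1 : 1 <= (n%:R : R) by rewrite ler1n.
  have [ad dl] : cdom a (defect (t / n%:R)) /\
      dist1 a (defect (t / n%:R)) <= e * `|t / n%:R| by near: n; exact: near_d.
  have tn : `|t / n%:R| = `|t| / n%:R by rewrite normrM normfV (gtr0_norm nR).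
  have tnt : `|t| / n%:R <= `|t| by rewrite ler_pdivrMr// ler_peMr.
  have et1 : e * (`|t| + 1) < s.
    have el : e <= s / (`|t| + 1) / 2 by rewrite /e ler_wpM2r// ge_min lexx orbT.
    rewrite (@le_lt_trans _ _ (s / 2))//; first by rewrite -ler_pdivlMr// mulrAC.
    by rewrite ltr_pdivrMr// ltr_pMr// ltr1n.
  have et2 : K * C * (e * (`|t| + 1)) < q.
    have el : e <= q / (K * C * (`|t| + 1)) / 2 by rewrite /e ler_wpM2r// ge_min lexx.
    rewrite mulrCA (@le_lt_trans _ _ (q / 2))//; first by rewrite -ler_pdivlMr// mulrAC.
    by rewrite ltr_pdivrMr// ltr_pMr// ltr1n.
  have ds : dist1 a (defect (t / n%:R)) < s.
    rewrite (le_lt_trans dl)// tn (le_lt_trans _ et1)// ler_wpM2l ?(ltW e0)//.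
    by rewrite (le_trans tnt)// lerDl.
  pose z := C * (e * (`|t| / n%:R)).
  have z0 : 0 <= z.
    by apply: mulr_ge0 (ltW C0) (mulr_ge0 (ltW e0) _); exact: divr_ge0.
  have fd i : (i < n)%N -> cdom a (twisted_flow (i%:R * (t / n%:R)) (defect (t / n%:R))) /\
      dist1 a (twisted_flow (i%:R * (t / n%:R)) (defect (t / n%:R))) <= z.
    move=> lin; have [|at' tl] := HC (i%:R * (t / n%:R)) _ _ ad ds.
      rewrite normrM tn ger0_norm// mulrCA ler_piMr// ler_pdivrMr// mul1r.
      by rewrite ler_nat ltnW.
    split => //; rewrite (le_trans tl)// ler_wpM2l ?(ltW C0)//.
    by rewrite -tn.
  have nd : n%:R * (K * z) < q.
    rewrite (le_lt_trans _ et2)// /z.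
    have -> : n%:R * (K * (C * (e * (`|t| / n%:R)))) = K * C * (e * `|t|).
      by field; rewrite gt_eqF.
    by rewrite ler_wpM2l ?mulr_ge0 ?(ltW C0)// ler_wpM2l ?(ltW e0)// lerDl.
  have ndr : n%:R * (K * z) < r by rewrite (lt_le_trans nd)// ge_min lexx.
  have dr : z < r.
    rewrite (le_lt_trans _ ndr)// mulrA ler_peMl// -[leLHS]mulr1 ler_pM//.
  have [ap pl] := dist1_prod fd z0 ndr dr.
  apply: HU => //; rewrite (le_lt_trans pl)// (lt_le_trans nd)//.
  by rewrite ge_min lexx orbT.
have mc := @mulg_right_continuous _ _ G (phi t) 1%g.
rewrite /continuous_at mul1g in mc.
move=> U /mc/small Hn.
change (\forall n \near \oo, U (\prod_(i < n) rho (i%:R * (t / n%:R))%R (eta (t / n%:R)%R))%g).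
near=> n.
have n0 : (n%:R : R) != 0 by rewrite pnatr_eq0 -lt0n; near: n; exists 1%N.
rewrite approximation_product [n%:R * _]mulrC divfK//.
by near: n; exact: Hn.
Unshelve. all: by end_near. Qed.

End Perturbation.
End NearIdentity.
End Trotter.

(** * The product formula *)

Section CommutingProducts.
Variables (R : realType) (d : nat) (G : lieGroupType R d).

Local Notation comp_prod n F :=
  (\big[(fun f g : G -> G => f \o g)/id]_(i < n) F i).

Lemma comp_prod_commute (n : nat) (F : 'I_n -> G -> G) (f : G -> G) :
  (forall i p, f (F i p) = F i (f p)) ->
  forall p, f (comp_prod n F p) = comp_prod n F (f p).
Proof.
elim: n F => [|n IH] F H p; first by rewrite !big_ord0.
rewrite !big_ord_recl /= H; congr (F _ _).
by apply: (IH (fun i => F (lift ord0 i))) => i q; exact: H.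
Qed.

Lemma commuting_product_flow (n : nat) (Phi : 'I_n -> R -> G -> G)
    (A : 'I_n -> field_coords G) (u : 'I_n -> R) :
  (forall i, automorphism_flow (Phi i) (A i)) ->
  (forall i j s t p, Phi i s (Phi j t p) = Phi j t (Phi i s p)) ->
  automorphism_flow (fun t => comp_prod n (fun i => Phi i (u i * t)))
    (fun a p => \sum_i u i *: A i a p).
Proof.
elim: n Phi A u => [|n IH] Phi A u PA PC.
  have -> : (fun t : R => comp_prod 0 (fun i => Phi i (u i * t))) = (fun _ p => p).
    by apply/funext => t; rewrite big_ord0.
  have -> : (fun a p => \sum_(i < 0) u i *: A i a p) = (fun _ _ => 0).
    by apply/funext => a; apply/funext => p; rewrite big_ord0.
  exact: automorphism_flow0.
have -> : (fun t : R => comp_prod n.+1 (fun i => Phi i (u i * t))) =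
    (fun t p => Phi ord0 (u ord0 * t)
       (comp_prod n (fun i => Phi (lift ord0 i) (u (lift ord0 i) * t)) p)).
  by apply/funext => t; rewrite big_ord_recl.
have -> : (fun a p => \sum_(i < n.+1) u i *: A i a p) = (fun a p => u ord0 *: A ord0 a p +
    \sum_(i < n) u (lift ord0 i) *: A (lift ord0 i) a p).
  by apply/funext => a; apply/funext => p; rewrite big_ord_recl.
apply: (automorphism_flowD (automorphism_flowZ (u ord0) (PA ord0))).
  by apply: (IH (fun i => Phi (lift ord0 i)) (fun i => A (lift ord0 i))
    (fun i => u (lift ord0 i))) => [i|i j s t p]; [exact: PA|exact: PC].
move=> s t p.
by apply: (comp_prod_commute (F := fun i => Phi (lift ord0 i) (u (lift ord0 i) * t))).
Qed.

End CommutingProducts.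

Unset Implicit Arguments.

Theorem theorem2p4 (R : realType) (d m : nat) (G : lieGroupType R d)
    (X Y : 'I_m.+1 -> field_coords G) (u : 'I_m.+1 -> R)
    (G_connected : connected [set: G])
    (X_linear : forall i, linear_field (X i))
    (X_commute : forall i j, fields_commute (X i) (X j))
    (Y_invariant : forall i, right_invariant (Y i))
    (u0 : u ord0 = 1) :
  let system : field_coords G := fun a g =>
    (X ord0 a g + Y ord0 a g) +
    \sum_(j < m) u (lift ord0 j) *: (X (lift ord0 j) a g + Y (lift ord0 j) a g)
  in
  exists phi : R -> G,
    [/\ forall t : R,
          (fun n : nat =>
             (\prod_(i < n)
                rho X (fun j => i%:R * u j * t / n%:R)%R
                  (lie_exp (fun a g =>
                     (t / n%:R) *: (\sum_(j < m.+1) u j *: Y j a g))%R))%g)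
            @ \oo --> phi t,
        integral_curve system phi,
        phi 0 = 1%g &
        forall psi : R -> G,
          integral_curve system psi -> psi 0 = 1%g -> psi = phi].
Proof.
move=> system.
pose A : field_coords G := fun a p => \sum_j u j *: X j a p.
pose Yu : field_coords G := fun a p => \sum_j u j *: Y j a p.
have sysE : system = (fun a p => A a p + Yu a p).
  apply/funext => a; apply/funext => p; rewrite /system /A /Yu !big_ord_recl u0 !scale1r.
  rewrite addrACA -big_split/=; congr (_ + _).
  by apply: eq_bigr => j _; rewrite scalerDr.
have flowX i := linear_field_flow (X_linear i).
have vX i : vector_field (X i) by case: (X_linear i).
have rA : automorphism_flow (fun t => rho X (fun j => u j * t)) A.
  apply: (@commuting_product_flow _ _ _ _ (fun i => flow (X i)) X u flowX) => i j.
  exact: commuting_automorphism_flows.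
have iY : invariant_field Yu.
  apply: invariant_field_sum => j; apply: invariant_fieldZ.
  by have [vY YR] := Y_invariant j; split => //; exact: vector_field_lipschitz.
have [phi [phi_curve phi0 phiD]] := affine_solution rA iY.
have [eta [eta_curve eta0 _]] := affine_solution (automorphism_flow0 G) iY.
have {}eta_curve : integral_curve Yu eta.
  have -> // : Yu = (fun a p => 0 + Yu a p).
  by apply/funext => a; apply/funext => p; rewrite add0r.
have lsys : lipschitz_field system.
  by rewrite sysE; case: rA => lA _ _ _ _; apply: lipschitz_fieldD lA _; case: iY.
have expE (k : R) : lie_exp (fun a g => k *: Yu a g) = eta k.
  have lk : lipschitz_field (fun a p => k *: Yu a p).
    by apply: lipschitz_fieldZ; case: iY.
  have e0 : eta (k * 0) = 1%g by rewrite mulr0.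
  have E := flow_integral_curve lk (integral_curve_rescale k eta_curve) e0.
  by rewrite /lie_exp -[LHS]/((flow _ ^~ 1%g) 1) E mulr1.
have [a aa a1] := atlas_cover (1%g : G).
have [K [r [K1 r0 Klip]]] := mul_lipschitz aa a1.
exists phi; split => //; last 2 first.
- by rewrite sysE.
- move=> psi psi_curve psi0.
  by apply: (integral_curve_unique lsys psi_curve); rewrite ?sysE// psi0 phi0.
- move=> t.
  have -> : (fun n : nat => \prod_(i < n) rho X (fun j => i%:R * u j * t / n%:R)%R
        (lie_exp (fun a g => (t / n%:R) *: (\sum_(j < m.+1) u j *: Y j a g))%R))%g =
      (fun n : nat => \prod_(i < n)
        rho X (fun j => u j * (i%:R * (t / n%:R)))%R (eta (t / n%:R)%R))%g.
    apply/funext => n; apply: eq_bigr => i _; rewrite -expE; congr (rho X _ _).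
    by apply/funext => j; rewrite mulrCA !mulrA.
  exact: (approximation_cvg aa a1 K1 r0 Klip rA phi_curve phi0 phiD eta_curve eta0).
Qed.
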